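(* Let $((\mathfrak g,\mu),\rho,T)$ be a relative Rota-Baxter Lie algebra with $\rho:\mathfrak g\to\mathfrak{gl}(V)$ and $T:V\to\mathfrak g$, and put $\pi=\mu+\rho$. Then $\big(s^{-1}L'\oplus\mathfrak h,\{l_k^{(s^{-1}\pi,T)}\}_{k\ge1}\big)$, the twisting of the $L_\infty$-algebra $(s^{-1}L'\oplus\mathfrak h,\{l_i\}_{i\ge1})$ by $(s^{-1}\pi,T)$, is an $L_\infty$-algebra. Moreover, for linear maps $T'\in\mathrm{Hom}(V,\mathfrak g)$, $\mu'\in\mathrm{Hom}(\wedge^2\mathfrak g,\mathfrak g)$ and $\rho'\in\mathrm{Hom}(\mathfrak g,\mathfrak{gl}(V))$, the triple $((\mathfrak g,\mu+\mu'),\rho+\rho',T+T')$ is again a relative Rota-Baxter Lie algebra if and only if $\big(s^{-1}(\mu'+\rho'),T'\big)$ is a Maurer-Cartan element of the twisted $L_\infty$-algebra $\big(s^{-1}L'\oplus\mathfrak h,\{l_k^{(s^{-1}\pi,T)}\}_{k\ge1}\big)$.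
   Context: $\mathbf K$ is a field of characteristic $0$. $\mathbb S_{(i,j)}$ denotes the set of $(i,j)$-shuffles, $\varepsilon(\sigma)$ the Koszul sign. Relative Rota-Baxter Lie algebra: a triple $((\mathfrak g,[\cdot,\cdot]_{\mathfrak g}),\rho,T)$ with $(\mathfrak g,[\cdot,\cdot]_{\mathfrak g})$ a Lie algebra (also written $(\mathfrak g,\mu)$ with $\mu=[\cdot,\cdot]_{\mathfrak g}$), $\rho:\mathfrak g\to\mathfrak{gl}(V)$ a representation, and $T:V\to\mathfrak g$ linear with $[Tu,Tv]_{\mathfrak g}=T(\rho(Tu)(v)-\rho(Tv)(u))$ for all $u,v\in V$. Nijenhuis-Richardson bracket and bidegree: put $C^n(\mathfrak g\oplus V,\mathfrak g\oplus V)=\mathrm{Hom}(\wedge^{n+1}(\mathfrak g\oplus V),\mathfrak g\oplus V)$ (degree $n\ge0$) and $L=\bigoplus_{n\ge0}C^n(\mathfrak g\oplus V,\mathfrak g\oplus V)$. For $P,Q$ of degrees $p,q$, $[P,Q]_{NR}=P\bar\circ Q-(-1)^{pq}Q\bar\circ P$ with $(P\bar\circ Q)(x_1,\dots,x_{p+q+1})=\sum_{\sigma\in\mathbb S_{(q+1,p)}}(-1)^\sigma P(Q(x_{\sigma(1)},\dots,x_{\sigma(q+1)}),x_{\sigma(q+2)},\dots,x_{\sigma(p+q+1)})$; this makes $L$ a graded Lie algebra. A map $f\in\mathrm{Hom}(\wedge^{k+l+1}(\mathfrak g\oplus V),\mathfrak g\oplus V)$ has bidegree $k|l$ if $f$ maps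 $\wedge^{k+1}\mathfrak g\otimes\wedge^lV$ to $\mathfrak g$, maps $\wedge^k\mathfrak g\otimes\wedge^{l+1}V$ to $V$, and vanishes on all other $\wedge^a\mathfrak g\otimes\wedge^bV$; the space of these is $C^{k|l}$. Multilinear maps $f:\wedge^k\mathfrak g\otimes\wedge^lV\to\mathfrak g$ (or $\to V$) are regarded as elements of $C^{k+l-1}$ via the lift $\hat f((x_1,v_1),\dots,(x_{k+l},v_{k+l}))=\sum_{\tau\in\mathbb S_{(k,l)}}(-1)^\tau f(x_{\tau(1)},\dots,x_{\tau(k)},v_{\tau(k+1)},\dots,v_{\tau(k+l)})$, placed in the summand $\mathfrak g$ (respectively $V$). Thus $C^{k|0}\cong\mathrm{Hom}(\wedge^{k+1}\mathfrak g,\mathfrak g)\oplus\mathrm{Hom}(\wedge^k\mathfrak g\otimes V,V)$ and $C^{-1|l}\cong\mathrm{Hom}(\wedge^lV,\mathfrak g)$. $L_\infty$-algebra: a $\mathbb Z$-graded vector space $E$ with degree $1$ graded symmetric maps $l_k:\otimes^kE\to E$ ($k\ge1$) with $\sum_{i=1}^n\sum_{\sigma\in\mathbb S_{(i,n-i)}}\varepsilon(\sigma)l_{n-i+1}(l_i(x_{\sigma(1)},\dots,x_{\sigma(i)}),x_{\sigma(i+1)},\dots,x_{\sigma(n)})=0$ for all $n\ge1$. A Maurer-Cartan element is $\alpha\in E^0$ with $\sum_{k\ge1}\frac1{k!}l_k(\alpha,\dots,\alpha)=0$. The twisting by a Maurer-Cartan element $\alpha$ has operations $l_k^\alpha(x_1,\dots,x_k)=\sum_{n\ge0}\frac1{n!}l_{k+n}(\underbrace{\alpha,\dots,\alpha}_n,x_1,\dots,x_k)$.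 In the algebra below all these sums are finite. The $L_\infty$-algebra $s^{-1}L'\oplus\mathfrak h$: $L'=\bigoplus_{n\ge0}C^{n|0}(\mathfrak g\oplus V,\mathfrak g\oplus V)$, a graded Lie subalgebra of $L$ with $C^{n|0}$ in degree $n$; $\mathfrak h=\bigoplus_{n\ge0}C^{-1|(n+1)}=\bigoplus_{n\ge0}\mathrm{Hom}(\wedge^{n+1}V,\mathfrak g)$ with $\mathrm{Hom}(\wedge^{n+1}V,\mathfrak g)$ in degree $n$; $(s^{-1}L')^i=L'^{i+1}$; $P:L\to L$ is the projection onto $\mathfrak h$ along the other bidegree components. The operations are $l_2(s^{-1}Q,s^{-1}Q')=(-1)^{Q}s^{-1}[Q,Q']_{NR}$ and $l_k(s^{-1}Q,\theta_1,\dots,\theta_{k-1})=P[\cdots[[Q,\theta_1]_{NR},\theta_2]_{NR},\cdots,\theta_{k-1}]_{NR}$ for homogeneous $Q,Q'\in L'$, $\theta_i\in\mathfrak h$; all operations not obtained from these by permuting arguments (with Koszul signs) vanish. The element $(s^{-1}\pi,T)$ is a Maurer-Cartan element of this $L_\infty$-algebra. *)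

(* Defs.v *)
From mathcomp Require Import all_boot all_order all_algebra all_fingroup.
From mathcomp Require Import all_classical.

Set Implicit Arguments.
Unset Strict Implicit.
Unset Printing Implicit Defensive.

Import GRing.Theory.
Local Open Scope classical_set_scope.
Local Open Scope ring_scope.

(* Spaces of functions carry the pointwise module structure of
   mathcomp.classical.functions; finitely supported sums over an infinite
   index set are those of mathcomp.classical.fsbigop. *)

Definition is_bilinear (K : fieldType) (X Y Z : lmodType K) (f : X -> Y -> Z) : Prop :=
  (forall x, linear (f x)) /\ (forall y, linear (f^~ y)).

(** Relative Rota-Baxter Lie algebras *)

Section RelativeRotaBaxter.
Variables (K : fieldType) (g V : lmodType K).

(* f is an element of Hom(/\^2 g, g). *)
Definition alt_bilinear (f : g -> g -> g) : Prop :=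
  is_bilinear f /\ forall x, f x x = 0.

Definition is_Lie_algebra (mu : g -> g -> g) : Prop :=
  alt_bilinear mu /\
  forall x y z, mu x (mu y z) + mu y (mu z x) + mu z (mu x y) = 0.

Definition is_representation (mu : g -> g -> g) (rho : g -> V -> V) : Prop :=
  is_bilinear rho /\
  forall x y v, rho (mu x y) v = rho x (rho y v) - rho y (rho x v).

Definition relative_Rota_Baxter (mu : g -> g -> g) (rho : g -> V -> V)
    (T : V -> g) : Prop :=
  [/\ is_Lie_algebra mu, is_representation mu rho, linear T &
      forall u v, mu (T u) (T v) = T (rho (T u) v - rho (T v) u)].

End RelativeRotaBaxter.

(** Shuffles *)

(* [:: x_(s 0); ...; x_(s (n-1))] for xs = [:: x_0; ...; x_(n-1)]. *)
Definition reorder (X : Type) (xs : seq X) (s : 'S_(size xs)) : seq X :=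
  [seq tnth (in_tuple xs) (s i) | i <- enum 'I_(size xs)].

(* s is an (i, n - i)-shuffle. *)
Definition is_shuffle (n i : nat) (s : 'S_n) : bool :=
  [forall a : 'I_n, forall b : 'I_n,
     ((a < b) && ((b < i) || (i <= a)))%N ==> (s a < s b)%N].

(** L_infinity algebras *)

(* A Z-graded vector space is given by its homogeneous components, submodules
   E d (d : int) of an ambient module M; only elements of the E d are ever
   considered, so that E stands for the external direct sum of the E d.  A
   homogeneous element is passed to an operation together with its degree, and
   the operations l_k are gathered in one function l on finite sequences,
   l_k being the restriction of l to the sequences of length k. *)

Section Linfty.
Variables (K : fieldType) (M : lmodType K).
Implicit Types (E : int -> set M) (l : seq (int * M) -> M) (xs : seq (int * M)).

Definition is_graded_space E : Prop :=
  forall d, E d 0 /\ forall (a : K) x y, E d x -> E d y -> E d (a *: x + y).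

Definition homogeneous E xs : Prop := {in xs, forall x, E x.1 x.2}.

Definition total_degree xs : int := \sum_(x <- xs) x.1.

Definition Koszul_sign xs (s : 'S_(size xs)) : K :=
  let d i := (tnth (in_tuple xs) (s i)).1 in
  \prod_(i < size xs) \prod_(j < size xs | ((i < j) && (s j < s i))%N)
    (-1) ^ (d i * d j).

Definition op_degree1 E l : Prop := forall xs, (0 < size xs)%N ->
  homogeneous E xs -> E (total_degree xs + 1) (l xs).

Definition op_multilinear E l : Prop :=
  forall xs ys (d : int) (a : K) (x y : M),
  homogeneous E xs -> homogeneous E ys -> E d x -> E d y ->
  l (xs ++ (d, a *: x + y) :: ys) =
    a *: l (xs ++ (d, x) :: ys) + l (xs ++ (d, y) :: ys).

Definition op_graded_symmetric E l : Prop :=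
  forall xs (s : 'S_(size xs)), (0 < size xs)%N -> homogeneous E xs ->
  l xs = Koszul_sign s *: l (reorder s).

(* The value of l at xs, with its degree. *)
Definition graded_value l xs : int * M := (total_degree xs + 1, l xs).

Definition generalized_Jacobi E l : Prop :=
  forall xs, (0 < size xs)%N -> homogeneous E xs ->
  \sum_(1 <= i < (size xs).+1) \sum_(s : 'S_(size xs) | is_shuffle i s)
     Koszul_sign s *:
       l (graded_value l (take i (reorder s)) :: drop i (reorder s)) = 0.

Definition is_Linfty_algebra E l : Prop :=
  [/\ is_graded_space E, op_degree1 E l, op_multilinear E l,
      op_graded_symmetric E l & generalized_Jacobi E l].

(* The series is required to have finite support: the sum of fsbigop is 0 by
   convention otherwise. *)
Definition is_Maurer_Cartan E l (alpha : M) : Prop :=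
  [/\ E 0 alpha,
      finite_set [set k | (0 < k)%N /\ l (nseq k (0, alpha)) <> 0] &
      \sum_(k \in [set k | (0 < k)%N])
         (k`!%:R : K)^-1 *: l (nseq k (0, alpha)) = 0].

(* Meant for algebras in which these sums are finite on homogeneous arguments.
   This is so for l_op below: for Q in C^{n|0}, P[...[[Q, t_1], t_2], ..., t_k]
   is nonzero only if k = n + 1. *)
Definition twist l (alpha : M) : seq (int * M) -> M := fun xs =>
  \sum_(n \in [set: nat]) (n`!%:R : K)^-1 *: l (nseq n (0, alpha) ++ xs).

End Linfty.

(** The graded Lie algebra of multilinear maps on g (+) V *)

(* A multilinear map in m variables is encoded as a function on finite
   sequences that vanishes at the sequences of length other than m. *)
Definition cochain (K : fieldType) (g V : lmodType K) : Type :=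
  seq (g * V)%type -> (g * V)%type.

Section NijenhuisRichardson.
Variables (K : fieldType) (g V : lmodType K).
Local Notation W := (g * V)%type.
Local Notation C := (cochain g V).
Implicit Types (f P Q : C) (ws : seq W).

(* f is an element of Hom(/\^m (g (+) V), g (+) V). *)
Definition alt_hom (m : nat) f : Prop :=
  [/\ forall ws, size ws != m -> f ws = 0,
      forall ws ws' (a : K) x y,
        f (ws ++ (a *: x + y) :: ws') =
        a *: f (ws ++ x :: ws') + f (ws ++ y :: ws') &
      forall ws, ~~ uniq ws -> f ws = 0].

(* f is an element of C^{k|l}. *)
Definition bidegree (k l : int) f : Prop :=
  exists m : nat, [/\ m%:Z = k + l + 1, alt_hom m f &
    forall (xs : seq g) (vs : seq V),
      let w := f ([seq (x, 0) | x <- xs] ++ [seq (0, v) | v <- vs]) in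
      (~ ((size xs)%:Z = k + 1 /\ (size vs)%:Z = l) -> w.1 = 0) /\
      (~ ((size xs)%:Z = k /\ (size vs)%:Z = l + 1) -> w.2 = 0)].

(* P \bar\circ Q for Q of degree q. *)
Definition NR_circ (q : nat) P Q : C := fun ws =>
  \sum_(s : 'S_(size ws) | is_shuffle q.+1 s)
     (-1 : K) ^+ s *: P (Q (take q.+1 (reorder s)) :: drop q.+1 (reorder s)).

(* The bracket of elements of L, each given with its degree. *)
Definition NR_bracket (P Q : nat * C) : nat * C :=
  ((P.1 + Q.1)%N,
   NR_circ Q.1 P.2 Q.2 - (-1 : K) ^+ (P.1 * Q.1) *: NR_circ P.1 Q.2 P.2).

(* The lifts of maps /\^k g (x) /\^l V -> g and /\^k g (x) /\^l V -> V. *)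
Definition lift_g (k l : nat) (f : seq g -> seq V -> g) : C := fun ws =>
  if size ws == (k + l)%N then
    \sum_(s : 'S_(size ws) | is_shuffle k s) (-1 : K) ^+ s *:
      (f [seq w.1 | w <- take k (reorder s)]
         [seq w.2 | w <- drop k (reorder s)], 0)
  else 0.

Definition lift_V (k l : nat) (f : seq g -> seq V -> V) : C := fun ws =>
  if size ws == (k + l)%N then
    \sum_(s : 'S_(size ws) | is_shuffle k s) (-1 : K) ^+ s *:
      (0, f [seq w.1 | w <- take k (reorder s)]
            [seq w.2 | w <- drop k (reorder s)])
  else 0.

Definition lift_mu (mu : g -> g -> g) : C :=
  lift_g 2 0 (fun xs _ => mu xs`_0 xs`_1).

Definition lift_rho (rho : g -> V -> V) : C :=
  lift_V 1 1 (fun xs vs => rho xs`_0 vs`_0).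

Definition lift_T (T : V -> g) : C := lift_g 0 1 (fun _ vs => T vs`_0).

(** The L_infinity algebra s^{-1}L' (+) h *)

Definition L'_space (n : int) : set C :=
  if n is Posz m then bidegree m%:Z 0 else [set 0].

Definition h_space (n : int) : set C :=
  if n is Posz m then bidegree (-1) (m%:Z + 1) else [set 0].

(* The pair (Q, theta) stands for s^{-1}Q + theta. *)
Definition sL'_h (d : int) : set (C * C)%type :=
  [set x | L'_space (d + 1) x.1 /\ h_space d x.2].

(* The projection onto h keeps the component /\V -> g. *)
Definition proj_h f : C := fun ws => ((f [seq (0, w.2) | w <- ws]).1, 0).

(* The components in L' and h of a homogeneous element of s^{-1}L' (+) h, with
   their degrees in L (the components are 0 when these are negative). *)
Definition L'_part (x : int * (C * C)) : nat * C := (absz (x.1 + 1), x.2.1).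
Definition h_part (x : int * (C * C)) : nat * C := (absz x.1, x.2.2).

(* P[...[[Q, theta_1], theta_2], ..., theta_k] *)
Definition derived_bracket (Q : nat * C) (thetas : seq (nat * C)) : C :=
  proj_h (foldl NR_bracket Q thetas).2.

(* Multilinear expansion of the operations: the first component is the one with
   two arguments in s^{-1}L'; the i-th term of the second component takes its
   argument in s^{-1}L' from position i, the Koszul sign being that of moving
   it to the front. *)
Definition l_op (xs : seq (int * (C * C))) : C * C :=
  let x i := tnth (in_tuple xs) i in
  (if xs is [:: x; y] then
     (-1 : K) ^+ (L'_part x).1 *: (NR_bracket (L'_part x) (L'_part y)).2
   else 0,
   \sum_(i < size xs) (-1 : K) ^ ((x i).1 * total_degree (take i xs)) *:
     derived_bracket (L'_part (x i)) (map h_part (take i xs ++ drop i.+1 xs))).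

End NijenhuisRichardson.

(* Main.v *)
(** The twisted operations at xs are the sum over n of l (alpha^n, xs) / n!, and
    alpha has even degree, so that the Jacobi identities of l at (alpha^n, xs) add
    up to the twisted one at xs.  In the same way the sum of the l^alpha (beta^k) / k!
    is that of the l ((alpha + beta)^n) / n!, so that beta is Maurer-Cartan for the
    twisted algebra iff alpha + beta is Maurer-Cartan for l.  It remains to see
    that (s^{-1}(mu + rho), T) is Maurer-Cartan for l iff (mu, rho, T) is a relative
    Rota-Baxter Lie algebra; with pi = mu + rho, the equation reads [pi, pi] = 0 and
    [[pi, T], T] = 0.

    That l itself is an L-infinity algebra is Voronov's derived bracket argument:
    h is an abelian subalgebra of L, and the kernel of P is a subalgebra.  All
    shuffle sums are rewritten as sums over splittings of a sequence, defined by
    recursion, for which coassociativity and cocommutativity are short inductions;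
    the pre-Lie identity of the Nijenhuis-Richardson product and all the Jacobi
    identities follow from these two laws. *)

Require Import Defs.
From mathcomp Require Import all_boot all_order all_algebra all_fingroup.
From mathcomp Require Import all_classical.
From mathcomp Require Import zify ring.

Set Implicit Arguments.
Unset Strict Implicit.
Unset Printing Implicit Defensive.

Import Order.TTheory GRing.Theory Num.Theory.
Local Open Scope classical_set_scope.
Local Open Scope ring_scope.

Local Notation sgn K b := ((-1 : K) ^+ (nat_of_bool b)).

(** * Sums over splittings *)

(** Signs depend on degrees only modulo 2, so brackets and operations are restated with boolean
    parities. Bidegrees, awkward to follow component by component through a composition, become
    eigenvalues: scaling V by 2 acts on C^{k|l} by 2^l, and the powers of 2 are distinct in
    characteristic 0, so additivity of bidegrees is a single computation. Characteristic 0 also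
    identifies alternating with antisymmetric maps and makes factorials invertible.

    Admitting an operation l_0, required to be 0, lets the Jacobi sum run over all splittings
    without a length condition; for a twisted algebra, l_0 = 0 is the Maurer-Cartan equation of
    alpha. Infinite sums are truncated at once: an operation vanishes when its number of arguments
    reaches a constant plus the sum of the absolute degrees, and inserting alpha, of degree 0, does
    not raise that bound.

    The relation below lists the pairs that [unsh] sums over; through [eq_unsh] it supplies sizes,
    parities and homogeneity of both parts under the sum. *)

Inductive splitting (X : Type) : seq X -> seq X -> seq X -> Prop :=
| splitting_nil : splitting [::] [::] [::]
| splitting_left x xs L R : splitting xs L R -> splitting (x :: xs) (x :: L) R
| splitting_right x xs L R : splitting xs L R -> splitting (x :: xs) L (x :: R).

Section Parity.
Variables (X : Type) (par : X -> bool).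
Implicit Types (xs L R : seq X).

Definition parity_by (xs : seq X) : bool := foldr (fun x b => par x (+) b) false xs.

Lemma parity_cat xs ys : parity_by (xs ++ ys) = parity_by xs (+) parity_by ys.
Proof. by elim: xs => //= x xs ->; rewrite addbA. Qed.

Lemma splitting_parity xs L R :
  splitting xs L R -> parity_by xs = parity_by L (+) parity_by R.
Proof. by elim=> //= x ? ? ? _ ->; [rewrite addbA | rewrite addbCA]. Qed.

Lemma splitting_size xs L R :
  splitting xs L R -> size xs = (size L + size R)%N.
Proof. by elim=> //= x ? ? ? _ ->; rewrite ?addSn ?addnS. Qed.

Lemma splitting_all (a : pred X) xs L R :
  splitting xs L R -> all a xs = all a L && all a R.
Proof. by elim=> //= x ? ? ? _ ->; [rewrite andbA | rewrite andbCA]. Qed.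

Lemma splitting_sum (M : nmodType) (f : X -> M) xs L R :
  splitting xs L R -> \sum_(x <- xs) f x = \sum_(x <- L) f x + \sum_(x <- R) f x.
Proof.
by elim=> [|x ? ? ? _ IH|x ? ? ? _ IH]; rewrite ?big_nil ?addr0 // !big_cons IH;
   [rewrite addrA | rewrite addrCA].
Qed.

End Parity.

Section Unshuffles.
Variables (K : pzRingType) (X : Type) (par : X -> bool).
Local Notation parity := (parity_by par).
Local Notation sgn b := ((-1 : K) ^+ (nat_of_bool b)).

Section Sum.
Variable M : lmodType K.
Implicit Types (F G : seq X -> seq X -> M) (xs : seq X).

(* The sum of the F L R over the coproduct of xs in the free graded symmetric
   coalgebra: all splittings of xs into subsequences L and R, with the Koszul
   sign; par is the parity of the degree. *)
Fixpoint unsh xs F : M :=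
  if xs is x :: xs' then
    unsh xs' (fun L R => F (x :: L) R) +
    unsh xs' (fun L R => sgn (par x && parity L) *: F L (x :: R))
  else F [::] [::].

Lemma eq_unsh xs F G :
  (forall L R, splitting xs L R -> F L R = G L R) -> unsh xs F = unsh xs G.
Proof.
elim: xs F G => [|x xs IH] F G eqFG /=; first by apply: eqFG; constructor.
by congr (_ + _); apply: IH => L R sLR; rewrite eqFG //; constructor.
Qed.

Lemma unsh0 xs : unsh xs (fun _ _ => 0) = 0.
Proof.
elim: xs => //= x xs IH; rewrite IH add0r -[RHS]IH.
by apply: eq_unsh => *; rewrite scaler0.
Qed.

Lemma unsh0P xs F : (forall L R, splitting xs L R -> F L R = 0) -> unsh xs F = 0.
Proof. by move=> F0; rewrite (eq_unsh F0) unsh0. Qed.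

Lemma unshD xs F G :
  unsh xs (fun L R => F L R + G L R) = unsh xs F + unsh xs G.
Proof.
elim: xs F G => //= x xs IH F G; rewrite IH addrACA; congr (_ + _).
by rewrite -IH; apply: eq_unsh => *; rewrite scalerDr.
Qed.

Lemma unsh_sum (I : Type) (r : seq I) (P : pred I) xs (F : I -> seq X -> seq X -> M) :
  unsh xs (fun L R => \sum_(i <- r | P i) F i L R) =
  \sum_(i <- r | P i) unsh xs (F i).
Proof.
elim: r => [|i r IH]; first by under eq_unsh do rewrite big_nil; rewrite big_nil unsh0.
rewrite big_cons -IH; case: ifP => Pi.
  by rewrite -unshD; apply: eq_unsh => *; rewrite big_cons Pi.
by apply: eq_unsh => *; rewrite big_cons Pi.
Qed.

End Sum.

Lemma unsh_lin (M M' : lmodType K) (h : M -> M') xs (F : seq X -> seq X -> M) :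
  (forall a x y, h (a *: x + y) = a *: h x + h y) ->
  h (unsh xs F) = unsh xs (fun L R => h (F L R)).
Proof.
move=> hl.
have h0 : h 0 = 0.
  by move: (hl 1 0 0); rewrite !scale1r addr0 => /(congr1 (fun z => z - h 0));
     rewrite subrr addrK.
have hZ a x : h (a *: x) = a *: h x by rewrite -[a *: x]addr0 hl h0 addr0.
elim: xs F => //= x xs IH F; rewrite -[X in X + _]scale1r hl scale1r !IH; congr (_ + _).
by apply: eq_unsh => L R _; rewrite hZ.
Qed.

End Unshuffles.

Lemma unsh_closed (K : pzRingType) (X : Type) (par : X -> bool) (M : lmodType K)
    (P : M -> Prop) xs (F : seq X -> seq X -> M) :
  P 0 -> (forall a x y, P x -> P y -> P (a *: x + y)) ->
  (forall L R, splitting xs L R -> P (F L R)) -> P (unsh par xs F).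
Proof.
move=> P0 Pl; elim: xs F => [|x xs IH] F PF /=; first by apply: PF; constructor.
rewrite -[X in X + _]scale1r; apply: (Pl); apply: IH => L R s.
  by apply: PF; constructor.
by rewrite -[_ *: _]addr0; apply: (Pl) => //; apply: PF; constructor.
Qed.

(** Pascal's rule: the two sums record the group that one further copy joins. It drives the
    inductions for [unsh_nseq] and [op_nseqD]. *)
Lemma Pascal_sum (M : nmodType) n (t : nat -> M) :
  \sum_(i < n.+1) t i.+1 *+ 'C(n, i) + \sum_(i < n.+1) t i *+ 'C(n, i) =
  \sum_(i < n.+2) t i *+ 'C(n.+1, i).
Proof.
rewrite [X in _ + X = _]big_ord_recl [RHS]big_ord_recl /= addrCA !bin0; congr (_ + _).
rewrite [X in _ + X](_ : _ = \sum_(i < n.+1) t i.+1 *+ 'C(n, i.+1)); last first.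
  by rewrite big_ord_recr /= bin_small // mulr0n addr0.
rewrite -big_split /=; apply: eq_bigr => i _.
by rewrite binS mulrnDr addrC.
Qed.

Section CommUnshuffles.
Variables (K : comPzRingType) (X : Type) (par : X -> bool) (M : lmodType K).
Local Notation parity := (parity_by par).
Local Notation sgn b := ((-1 : K) ^+ (nat_of_bool b)).
Local Notation unsh := (unsh par).
Implicit Types (F G : seq X -> seq X -> M) (xs : seq X).

Lemma unshZ (a : K) xs F : unsh xs (fun L R => a *: F L R) = a *: unsh xs F.
Proof.
symmetry; apply: (@unsh_lin _ _ par _ _ (fun v => a *: v)) => b x y.
by rewrite scalerDr !scalerA mulrC.
Qed.

Lemma unshN xs F : unsh xs (fun L R => - F L R) = - unsh xs F.
Proof.
by rewrite -scaleN1r -unshZ; apply: eq_unsh => *; rewrite scaleN1r.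
Qed.

Lemma unsh_cocomm xs F :
  unsh xs F = unsh xs (fun L R => sgn (parity L && parity R) *: F R L).
Proof.
elim: xs F => [|x xs IH] F /=; first by rewrite scale1r.
rewrite addrC IH [X in _ + X]IH; congr (_ + _); apply: eq_unsh => L R _;
  rewrite !scalerA -!signr_addb; congr (sgn _ *: _);
  by case: (par x); case: (parity L); case: (parity R).
Qed.

Lemma unsh_coassoc xs (F : seq X -> seq X -> seq X -> M) :
  unsh xs (fun L R => unsh L (fun A B => F A B R)) =
  unsh xs (fun A S => unsh S (fun B R => F A B R)).
Proof.
elim: xs F => [|x xs IH] F //=.
rewrite !unshD !IH -!addrA; congr (_ + _).
have -> : unsh xs (fun A S => sgn (par x && parity A) *:
    (unsh S (fun B R => F A (x :: B) R) +
     unsh S (fun B R => sgn (par x && parity B) *: F A B (x :: R)))) =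
  unsh xs (fun A S => unsh S (fun B R => sgn (par x && parity A) *: F A (x :: B) R)) +
  unsh xs (fun A S => unsh S (fun B R => sgn (par x && (parity A (+) parity B)) *: F A B
    (x :: R))).
  rewrite -unshD; apply: eq_unsh => A S _; rewrite scalerDr -!unshZ; congr (_ + _).
  apply: eq_unsh => B R _; rewrite scalerA -signr_addb; congr (sgn _ *: _).
  by case: (par x).
rewrite -!IH; congr (_ + _); apply: eq_unsh => L R _; rewrite -unshZ.
by apply: eq_unsh => A B /splitting_parity ->.
Qed.

(** Coassociativity turns both sides into one fourfold splitting, where cocommutativity exchanges
    the two middle parts; hence the sign in [B] and [C]. *)
Lemma unsh_interchange xs (F : seq X -> seq X -> seq X -> seq X -> M) :
  unsh xs (fun L R => unsh L (fun A B => unsh R (fun C D => F A B C D))) =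
  unsh xs (fun L R => unsh L (fun A C => unsh R (fun B D =>
     sgn (parity B && parity C) *: F A B C D))).
Proof.
have E1 (H : seq X -> seq X -> seq X -> seq X -> M) :
    unsh xs (fun L R => unsh L (fun A B => unsh R (fun C D => H A B C D))) =
    unsh xs (fun A S => unsh S (fun T D => unsh T (fun B C => H A B C D))).
  rewrite (unsh_coassoc _ (fun A B R => unsh R (fun C D => H A B C D))).
  by apply: eq_unsh => A S _; rewrite (unsh_coassoc S (fun B C D => H A B C D)).
rewrite E1 (E1 (fun A C B D => sgn (parity B && parity C) *: F A B C D)).
apply: eq_unsh => A S _; apply: eq_unsh => T D _; rewrite unsh_cocomm.
by apply: eq_unsh => C B _; rewrite andbC.
Qed.

(** If [x] and [y] land on the same side, the symmetry of [F] there is used; if they are separated,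
    the two mixed terms trade places. The predicate [S] is for homogeneity, since graded symmetry of
    the operations is available only on homogeneous entries. *)
Lemma unsh_swap (S : pred X) us x y vs F :
  (forall us vs R, all S (us ++ x :: y :: vs) -> all S R ->
     F (us ++ x :: y :: vs) R = sgn (par x && par y) *: F (us ++ y :: x :: vs) R) ->
  (forall us vs L, all S (us ++ x :: y :: vs) -> all S L ->
     F L (us ++ x :: y :: vs) = sgn (par x && par y) *: F L (us ++ y :: x :: vs)) ->
  all S (us ++ x :: y :: vs) ->
  unsh (us ++ x :: y :: vs) F = sgn (par x && par y) *: unsh (us ++ y :: x :: vs) F.
Proof.
elim: us F => [|u us IH] F HL HR; rewrite ?cat_cons.
  rewrite [all _ _]/= => /and3P[Sx Sy Svs] /=; rewrite -!addrA !scalerDr.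
  rewrite -!unshZ.
  have Sv L R : splitting vs L R -> all S L /\ all S R.
    by move=> sv; move: Svs; rewrite (splitting_all _ sv) => /andP.
  congr (_ + _); last rewrite addrCA; last congr (_ + (_ + _)).
  - apply: eq_unsh => L R /Sv[SL SR].
    by apply: (HL [::]); rewrite //= Sx Sy.
  - apply: eq_unsh => L R _; rewrite !scalerA -!signr_addb; congr (sgn _ *: _).
    by case: (par x); case: (par y); case: (parity L).
  - apply: eq_unsh => L R _; rewrite !scalerA -!signr_addb; congr (sgn _ *: _).
    by case: (par x); case: (par y); case: (parity L).
  apply: eq_unsh => L R /Sv[SL SR].
  rewrite (HR [::]) //= ?Sx ?Sy // !scalerA -!signr_addb; congr (sgn _ *: _).
  by case: (par x); case: (par y); case: (parity L).
move=> /=/andP[Su Sxs]; rewrite scalerDr; congr (_ + _).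
  apply: IH => // us' vs' R; last by move=> *; apply: HR => //=; apply/andP.
  by move=> SL SR; rewrite (HL (u :: us')) //= Su.
apply: IH => // us' vs' R.
  move=> SL SR; rewrite HL //=; last by rewrite Su.
  rewrite !scalerA -!signr_addb; congr (sgn _ *: _).
  rewrite !parity_cat /=.
  by case: (par x); case: (par y); case: (par u); case: (parity us'); case: (parity vs').
move=> SR SL; rewrite (HR (u :: us')) //=; last by rewrite Su.
by rewrite !scalerA mulrC.
Qed.

(** Entries will be pairs of a degree and an element, which are not added as pairs: [z] stands for
    the linear combination of [x] and [y] taken in their common degree. *)
Lemma unsh_mlin (S : pred X) us (a : K) x y z vs F :
  par x = par z -> par y = par z ->
  (forall us vs R, all S us -> all S vs -> all S R ->
     F (us ++ z :: vs) R = a *: F (us ++ x :: vs) R + F (us ++ y :: vs) R) ->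
  (forall us vs L, all S us -> all S vs -> all S L ->
     F L (us ++ z :: vs) = a *: F L (us ++ x :: vs) + F L (us ++ y :: vs)) ->
  all S us -> all S vs ->
  unsh (us ++ z :: vs) F = a *: unsh (us ++ x :: vs) F + unsh (us ++ y :: vs) F.
Proof.
move=> parx pary; elim: us F => [|u us IH] F HL HR.
  move=> _ Svs /=; rewrite parx pary !scalerDr addrACA -!unshZ -!unshD.
  have Sv L R : splitting vs L R -> all S L /\ all S R.
    by move=> sv; move: Svs; rewrite (splitting_all _ sv) => /andP.
  apply: eq_unsh => L R /Sv[SL SR]; congr (_ + _); first exact: (HL [::]).
  by rewrite (HR [::]) // scalerDr !scalerA mulrC.
move=> /=/andP[Su Sus] Svs; rewrite !scalerDr addrACA; congr (_ + _).
  apply: IH => // us' vs' R; last by move=> *; apply: HR => //=; apply/andP.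
  by move=> SL SR ?; rewrite (HL (u :: us')) //= Su.
apply: IH => // us' vs' R.
  move=> S1 S2 SR; rewrite HL //=; last by rewrite Su.
  by rewrite scalerDr !scalerA !parity_cat /= parx pary mulrC.
move=> S1 S2 SL; rewrite (HR (u :: us')) //=; last by rewrite Su.
by rewrite scalerDr !scalerA mulrC.
Qed.

(** Copies of an even [e] move without sign, so all choices of i copies among n give the same
    term. *)
Lemma unsh_nseq n e ys F : par e = false ->
  unsh (nseq n e ++ ys) F =
  \sum_(i < n.+1) unsh ys (fun L R => F (nseq i e ++ L) (nseq (n - i) e ++ R)) *+ 'C(n, i).
Proof.
move=> pe; elim: n F => [|n IH] F; first by rewrite big_ord1 mulr1n.
have pn i : parity (nseq i e) = false by elim: i => //= i ->; rewrite pe.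
pose t i := unsh ys (fun L R => F (nseq i e ++ L) (nseq (n.+1 - i) e ++ R)).
have -> : unsh (nseq n.+1 e ++ ys) F =
    \sum_(i < n.+1) t i.+1 *+ 'C(n, i) + \sum_(i < n.+1) t i *+ 'C(n, i).
  rewrite [LHS]/= !IH; congr (_ + _); apply: eq_bigr => i _; congr (_ *+ _).
  apply: eq_unsh => L R _; rewrite pe scale1r subSn ?cat_cons //.
  by rewrite -ltnS.
exact: Pascal_sum.
Qed.

End CommUnshuffles.

(** * Shuffles as permutations *)

Section OrdSeq.
Variable X : Type.

Lemma nth_map_enum n (f : 'I_n -> X) x0 (j : 'I_n) :
  nth x0 [seq f i | i <- enum 'I_n] j = f j.
Proof. by rewrite (nth_map j) ?size_enum_ord // nth_ord_enum. Qed.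

Lemma take_enum_ord n i : take i (enum 'I_n) = [seq a : 'I_n <- enum 'I_n | (a < i)%N].
Proof.
apply: (inj_map val_inj); rewrite map_take val_enum_ord.
rewrite -[in RHS](filter_map val (fun a => a < i)%N) val_enum_ord.
have [ltin|leni] := ltnP i n.
  by rewrite take_iota (minn_idPl (ltnW ltin)) -(filter_iota_ltn 0 (ltnW ltin)).
rewrite take_oversize ?size_iota //; symmetry; apply/all_filterP/allP => a.
by rewrite mem_iota => /andP[_]; rewrite add0n => /leq_trans; apply.
Qed.

(** Permutations are decomposed by the position [i] that receives the first entry, to match the
    recursion of [unsh] on the head of the sequence. *)
Lemma map_lift_perm0 n (x : 'I_n.+1 -> X) (i : 'I_n.+1) (s : 'S_n) :
  let ys := [seq x (lift ord0 (s j)) | j <- enum 'I_n] in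
  [seq x (lift_perm i ord0 s j) | j <- enum 'I_n.+1] =
  take i ys ++ x ord0 :: drop i ys.
Proof.
move=> ys; have sz : size ys = n by rewrite size_map size_enum_ord.
have lein : (i <= n)%N by rewrite -ltnS.
apply: (@eq_from_nth _ (x ord0)) => [|k].
  by rewrite size_map size_enum_ord size_cat /= size_takel ?sz // size_drop sz addnS subnKC.
rewrite size_map size_enum_ord => ltkn; rewrite -[k]/(val (Ordinal ltkn)).
move: (Ordinal ltkn) => {ltkn}k; rewrite nth_map_enum nth_cat size_takel ?sz //.
case: (unliftP i k) => [j|] -> /=; last first.
  by rewrite lift_perm_id ltnn subnn.
rewrite lift_perm_lift /bump; case: (leqP i j) => [leij|ltji].
  rewrite add1n ltnNge ltnW //= subSn //= nth_drop subnKC //.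
  by rewrite (nth_map_enum (fun j => x (lift ord0 (s j)))).
by rewrite add0n ltji nth_take // (nth_map_enum (fun j => x (lift ord0 (s j)))).
Qed.

End OrdSeq.

Lemma reindex_lift_perm0 (M : nmodType) n (P : pred 'S_n.+1) (F : 'S_n.+1 -> M) :
  \sum_(s | P s) F s =
  \sum_(i < n.+1) \sum_(s : 'S_n | P (lift_perm i ord0 s)) F (lift_perm i ord0 s).
Proof.
rewrite pair_big_dep /=.
pose f (u : 'I_n.+1 * 'S_n) := lift_perm u.1 ord0 u.2.
rewrite (reindex f) /=; first by apply: eq_bigl => -[].
apply: onW_bij; apply: inj_card_bij.
  move=> [i s] [j t]; rewrite /f /= => eq_st.
  have eq_ij : i = j.
    by apply: (perm_inj (s := lift_perm i ord0 s)); rewrite {2}eq_st !lift_perm_id.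
  rewrite -{}eq_ij in eq_st *; congr pair; apply/permP => k.
  by apply: (@lift_inj _ ord0); rewrite -!(lift_perm_lift i) eq_st.
by rewrite card_prod !card_Sn card_ord factS.
Qed.

(** By counting: otherwise [reindex_lift_perm0], applied to the indicator of [s], would give 1 =
    0. *)
Lemma lift_perm0_ex n (s : 'S_n.+1) : exists i t, s = lift_perm i ord0 t.
Proof.
apply/not_existsP => H.
have := reindex_lift_perm0 (pred1 s) (fun _ => 1%N).
rewrite big_pred1_eq big1 // => i _; rewrite big1 // => t /eqP e.
by case: (H i); exists t.
Qed.

Section Koszul.
Variable K : comPzRingType.

(** [Koszul_sign] in terms of parities. When all are odd it is the signature ([koszul_odd]), so one
    comparison of shuffles with splittings serves both the bracket and the L-infinity operations. *)
Definition koszul n (p : 'I_n -> bool) (s : 'S_n) : K :=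
  \prod_(i < n) \prod_(j < n | ((i < j) && (s j < s i))%N) sgn K (p (s i) && p (s j)).

Lemma prod_sgn n (q : 'I_n -> bool) b i :
  \prod_(a < n | (a < i)%N) sgn K (q a && b) =
  sgn K (b && parity_by id (take i [seq q j | j <- enum 'I_n])).
Proof.
rewrite -map_take take_enum_ord -big_filter.
rewrite [index_enum _](_ : _ = enum 'I_n); last by rewrite enumT.
elim: [seq _ <- _ | _] => [|a r IH]; first by rewrite big_nil andbF.
rewrite big_cons {}IH -signr_addb /=.
by congr (sgn K _); case: b; case: (q a); case: (parity_by _ _).
Qed.

(** The inversions are those of [s] together with the pairs formed by the first entry, now at
    position [i], and each entry placed before it. *)
Lemma koszul_lift_perm0 n (p : 'I_n.+1 -> bool) i (s : 'S_n) :
  koszul p (lift_perm i ord0 s) =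
  sgn K (p ord0 && parity_by id (take i [seq p (lift ord0 (s j)) | j <- enum 'I_n])) *
  koszul (p \o lift ord0) s.
Proof.
rewrite /koszul (bigD1_ord i) //= big1 ?mul1r; last first.
  by move=> j; rewrite lift_perm_id ltn0 andbF.
rewrite -(prod_sgn (fun j => p (lift ord0 (s j)))) [X in _ = X * _]big_mkcond -big_split /=.
apply: eq_bigr => a _; rewrite !lift_perm_lift.
have lt_lift (k : 'I_n.+1) (u v : 'I_n) : (lift k u < lift k v)%N = (u < v)%N.
  by rewrite !ltnNge /= leq_bump2.
rewrite big_mkcond (bigD1_ord i) //= lift_perm_id.
rewrite (_ : (bump i a < i)%N = (a < i)%N); last by rewrite /bump; case: leqP; lia.
rewrite andbT; congr (_ * _); rewrite [RHS]big_mkcond; apply: eq_bigr => b _ /=.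
by rewrite !lift_perm_lift (lt_lift i) (lt_lift ord0).
Qed.

Lemma koszul_odd n (s : 'S_n) : koszul xpredT s = sgn K s.
Proof.
elim: n s => [|n IH] s.
  by rewrite /koszul big_ord0 (_ : s = 1%g) ?odd_perm1 //; apply/permP; case.
have [i [t ->]] := lift_perm0_ex s.
rewrite koszul_lift_perm0 IH odd_lift_perm addbF -signr_addb.
congr (sgn K (_ (+) _)); have -> : [seq true | _ <- enum 'I_n] = nseq n true.
  by rewrite -[in RHS](size_enum_ord n); elim: (enum _) => //= _ r ->.
rewrite take_nseq -1?ltnS //.
by elim: (nat_of_ord i) => //= k ->.
Qed.

End Koszul.

(** The smallest entry must head one of the two increasing blocks, which begin at positions 0 and
    [k]. For [k] = 0 the first block is empty, and the test [0 < k] attributes this case to the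
    second block only. *)
Lemma is_shuffle_lift_perm0 n k (i : 'I_n.+1) (s : 'S_n) : (k <= n.+1)%N ->
  is_shuffle k (lift_perm i ord0 s) =
  ((i == 0 :> nat) && (0 < k) && is_shuffle k.-1 s ||
   (i == k :> nat) && is_shuffle k s)%N.
Proof.
move=> lekn; set t := lift_perm i ord0 s.
have ti : t i = ord0 by rewrite /t lift_perm_id.
have tl j : t (lift i j) = lift ord0 (s j) by rewrite /t lift_perm_lift.
apply/idP/idP => [/'forall_forallP sh | sh].
  have {}sh (a b : 'I_n.+1) : (a < b)%N -> ((b < k) || (k <= a))%N -> (t a < t b)%N.
    by move=> ab bk; have /implyP := sh a b; apply; rewrite ab.
  have sh' k' : (forall a b : 'I_n, (a < b)%N -> ((b < k') || (k' <= a))%N ->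
      (lift i a < lift i b)%N /\ ((lift i b < k) || (k <= lift i a))%N) -> is_shuffle k' s.
    move=> H; apply/'forall_forallP => a b; apply/implyP => /andP[ab bk].
    by have [ab' bk'] := H a b ab bk; have := sh _ _ ab' bk'; rewrite !tl.
  have [i0|i0] := posnP i.
    have [k0|k0] := posnP k.
      rewrite i0 k0 /=; apply: sh' => a b ab bk; rewrite /= /bump i0 k0; lia.
    rewrite /=; apply/orP; left; apply: sh' => a b ab bk; rewrite /= /bump i0; lia.
  have ltik : (k <= i)%N.
    by rewrite leqNgt; apply/negP => ik; have := sh ord0 i i0;
      rewrite ik ti ltn0 => /(_ isT).
  have ik : i = k :> nat.
    apply/eqP; rewrite eqn_leq ltik andbT leqNgt; apply/negP => ki.
    have kn : (k < n.+1)%N by rewrite (leq_trans ki) // ltnW.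
    by have := sh (Ordinal kn) i ki; rewrite ti ltn0 leqnn orbT => /(_ isT).
  rewrite ik eqxx /=; apply: sh' => a b ab bk.
  by rewrite /= /bump ik; do 2![case: leqP => ?] => //; lia.
apply/'forall_forallP => a b; apply/implyP => /andP[].
case: (unliftP i a) => [a'|] ->; case: (unliftP i b) => [b'|] ->; rewrite ?ti ?ltnn ?tl //.
  rewrite [(lift i a' < _)%N]ltnNge /= leq_bump2 -ltnNge => ab bk.
  rewrite /bump /= !add1n ltnS;
    case/orP: sh => /andP[H /'forall_forallP/(_ a' b')/implyP]; apply;
    rewrite ab /=.
    by case/andP: H bk => /eqP-> ?; rewrite /bump; lia.
  by move/eqP: H bk => ->; rewrite /bump; do 2![case: leqP => ?] => //; lia.
by case/orP: sh => /andP[H _]; [case/andP: H => /eqP -> _ | move/eqP: H => ->]; lia.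
Qed.

Section Bridge.
Variables (K : comPzRingType) (X : Type) (par : X -> bool) (M : lmodType K).
Local Notation parity := (parity_by par).
Implicit Types (F : seq X -> seq X -> M) (l : seq X -> M).

Lemma parity_map n (x : 'I_n -> X) :
  forall r, parity_by id [seq par (x i) | i <- r] = parity [seq x i | i <- r].
Proof. by elim=> //= i r ->. Qed.

(** Induction on the number of entries: shuffles whose left block is headed by the first entry match
    the first summand of [unsh], those whose right block is, the second. *)
Lemma sum_shuffle n k (x : 'I_n -> X) F : (k <= n)%N ->
  let xs (s : 'S_n) := [seq x (s i) | i <- enum 'I_n] in
  \sum_(s : 'S_n | is_shuffle k s)
     koszul K (par \o x) s *: F (take k (xs s)) (drop k (xs s)) =
  unsh par [seq x i | i <- enum 'I_n] (fun L R => if size L == k then F L R else 0).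
Proof.
elim: n k x F => [|n IH] k x F lekn xs.
  case: k lekn => // _; rewrite (big_pred1 1%g) /xs; last first.
    move=> s; rewrite [pred1 _ _](_ : _ = true).
      by apply/'forall_forallP => -[].
    by apply/eqP/permP => -[].
  by rewrite (size0nil (size_enum_ord 0)) /koszul big_ord0 scale1r.
rewrite enum_ordSl /= reindex_lift_perm0 /xs.
set y := fun i => x (lift ord0 i); set ys := map x _.
have ysE : ys = [seq y i | i <- enum 'I_n] by rewrite /ys -map_comp.
have szy (s : 'S_n) : size [seq y (s j) | j <- enum 'I_n] = n by rewrite size_map
  size_enum_ord.
have -> : unsh par ys (fun L R => if (size L).+1 == k then F (x ord0 :: L) R else 0) =
    \sum_(i < n.+1 | (i == 0 :> nat) && (0 < k)%N)
      \sum_(s : 'S_n | is_shuffle k (lift_perm i ord0 s))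
      koszul K (par \o x) (lift_perm i ord0 s) *:
      F (take k [seq x (lift_perm i ord0 s i0) | i0 <- enum 'I_n.+1])
        (drop k [seq x (lift_perm i ord0 s i0) | i0 <- enum 'I_n.+1]).
  have [k0|k0] := posnP k.
    rewrite big_pred0 => [|i]; last by rewrite andbF.
    by apply: unsh0P => L R _; rewrite k0.
  rewrite (big_pred1 ord0) => [|i]; last by rewrite andbT.
  case: k lekn k0 => // k lekn _.
  rewrite ysE -(IH k y (fun L R => F (x ord0 :: L) R)) //.
  apply: eq_big => s; first by rewrite is_shuffle_lift_perm0 //= orbF.
  by rewrite (map_lift_perm0 x) koszul_lift_perm0 /= !take0 drop0 andbF mul1r.
have -> : unsh par ys (fun L R => sgn K (par (x ord0) && parity L) *:
      (if size L == k then F L (x ord0 :: R) else 0)) =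
    \sum_(i < n.+1 | i == k :> nat)
      \sum_(s : 'S_n | is_shuffle k (lift_perm i ord0 s))
      koszul K (par \o x) (lift_perm i ord0 s) *:
      F (take k [seq x (lift_perm i ord0 s i0) | i0 <- enum 'I_n.+1])
        (drop k [seq x (lift_perm i ord0 s i0) | i0 <- enum 'I_n.+1]).
  (* For [k] = n + 1 the right block is empty: there is no position [k], and no left part of a
     splitting of the tail is that long. *)
  move: lekn; rewrite leq_eqVlt => /orP[/eqP -> |ltkn].
    rewrite big_pred0 => [|i]; last by rewrite ltn_eqF.
    apply: unsh0P => L R /splitting_size; rewrite ysE size_map size_enum_ord => E.
    by case: eqP => [e|]; [lia | rewrite scaler0].
  rewrite (big_pred1 (Ordinal ltkn)) // ysE.
  rewrite (_ : unsh _ _ _ = unsh par [seq y i | i <- enum 'I_n] (fun L R => if size L ==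
    k then
      sgn K (par (x ord0) && parity L) *: F L (x ord0 :: R) else 0)); last first.
    by apply: eq_unsh => L R _; case: ifP; rewrite ?scaler0.
  rewrite -(IH k y (fun L R => sgn K (par (x ord0) && parity L) *: F L (x ord0 :: R))) //.
  apply: eq_big => s.
    rewrite is_shuffle_lift_perm0 //=; last exact: ltnW.
    by rewrite eqxx /=; case: (posnP k) => [->|k0] /=; rewrite ?k0 ?andbF ?orbb ?orbF //
      gtn_eqF.
  rewrite (map_lift_perm0 x) koszul_lift_perm0 /= -/y => _.
  have szt : size (take k [seq y (s j) | j <- enum 'I_n]) = k by rewrite size_takel ?szy.
  rewrite take_cat drop_cat szt ltnn subnn take0 drop0 cats0 scalerA mulrC.
  congr (_ * _ *: _); congr (sgn K (_ && _)).
  by rewrite -!map_take (parity_map (fun i => y (s i))).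
rewrite (bigID (fun i : 'I_n.+1 => (i == 0 :> nat) && (0 < k)%N)) /=; congr (_ + _).
rewrite (bigID (fun i : 'I_n.+1 => (i == k :> nat))) /= [X in _ + X]big1 ?addr0.
  by apply: eq_bigl => i; case: eqP; case: eqP; lia.
move=> i /andP[i0 ik]; apply: big1 => s.
by rewrite is_shuffle_lift_perm0 // (negPf i0) (negPf ik).
Qed.

Section Symmetric.
Variable S : pred X.

Definition graded_sym l := forall us x y vs, all S (us ++ x :: y :: vs) ->
  l (us ++ x :: y :: vs) = sgn K (par x && par y) *: l (us ++ y :: x :: vs).

Lemma graded_sym_move l us x vs ws : graded_sym l ->
  all S (us ++ vs ++ x :: ws) ->
  l (us ++ vs ++ x :: ws) = sgn K (par x && parity vs) *: l (us ++ x :: vs ++ ws).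
Proof.
move=> sl; elim: vs us => [|v vs IH] us; first by rewrite andbF scale1r.
move=> H; rewrite cat_cons -cat_rcons IH ?cat_rcons // sl.
  rewrite scalerA -signr_addb /=; congr (sgn K _ *: _).
  by case: (par x); case: (par v); case: (parity _).
by move: H; rewrite !all_cat /= !all_cat /=;
  do ![case: (all _ _) => //=|case: (S _) => //=].
Qed.

(** Adjacent transpositions suffice: the tail is permuted by induction, then [graded_sym_move]
    brings the first entry to its place; the signs are the two factors in [koszul_lift_perm0]. *)
Lemma graded_sym_perm n l (x : 'I_n -> X) (s : 'S_n) : graded_sym l ->
  (forall i, S (x i)) ->
  l [seq x i | i <- enum 'I_n] =
  koszul K (par \o x) s *: l [seq x (s i) | i <- enum 'I_n].
Proof.
elim: n l x s => [|n IH] l x s sl Sx.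
  by rewrite (size0nil (size_enum_ord 0)) /koszul big_ord0 scale1r.
have [i [t ->]] := lift_perm0_ex s.
rewrite koszul_lift_perm0 (map_lift_perm0 x) enum_ordSl /= -map_comp.
pose y := x \o lift ord0; pose ys := [seq y (t j) | j <- enum 'I_n].
have sl' : graded_sym (fun r => l (x ord0 :: r)).
  by move=> us a b vs H; rewrite -!cat_cons sl //= Sx.
rewrite (IH _ y t sl') => [|j]; last exact: Sx.
rewrite mulrC -scalerA; congr (_ *: _); rewrite -/ys.
have Sys : all S ys by rewrite all_map; apply/allP => j _; apply: Sx.
change (l (x ord0 :: ys) = sgn K (par (x ord0) && parity_by id
  (take i [seq par (y (t j)) | j <- enum 'I_n])) *: l (take i ys ++ x ord0 :: drop i ys)).
rewrite -[take i ys ++ _]cat0s (@graded_sym_move l [::] (x ord0) (take i ys) (drop i ys))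
  //; last first.
  by rewrite !all_cat /= Sx /= -all_cat cat_take_drop.
rewrite scalerA -signr_addb /= cat_take_drop.
by rewrite -map_take (parity_map (fun j => y (t j))) map_take addbb scale1r.
Qed.

End Symmetric.

End Bridge.

(** * The Nijenhuis-Richardson bracket *)

Lemma addr_cancel (M : zmodType) (x y : M) : x + (- x + y) = y.
Proof. by rewrite addrA subrr add0r. Qed.

Lemma subr_cancel (M : zmodType) (x y : M) : - x + (x + y) = y.
Proof. by rewrite addrA addNr add0r. Qed.

(** [zmod_cancel] proves identities in abelian groups: the difference is flattened, and each leading
    summand is cancelled against its opposite, which [zmod_pull] brings forward. *)
Ltac zmod_pull y :=
  first [rewrite addr_cancel | rewrite subr_cancel | rewrite (addrCA _ y); zmod_pull y].
Ltac zmod_loop :=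
  lazymatch goal with
  | |- 0 = 0 => reflexivity
  | |- - ?x + _ = 0 => zmod_pull x; zmod_loop
  | |- ?x + _ = 0 => zmod_pull (- x); zmod_loop
  end.
Ltac zmod_cancel :=
  apply/subr0_eq; rewrite -[LHS]addr0 ?opprD ?opprK ?oppr0 ?addr0 -?addrA -[LHS]addr0
    -?addrA; zmod_loop.

Section Cochains.
Variables (K : fieldType) (g V : lmodType K).
Local Notation W := (g * V)%type.
Local Notation C := (cochain g V).
Local Notation unsh := (unsh (K := K) (fun _ : W => true)).
Local Notation parity := (parity_by (fun _ : W => true)).
Local Notation sgn b := (sgn K b).
Implicit Types (f h P Q N : C) (ws us vs : seq W).

Lemma cochDE f h ws : (f + h) ws = f ws + h ws. Proof. by []. Qed.
Lemma cochZE (a : K) f ws : (a *: f) ws = a *: f ws. Proof. by []. Qed.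
Lemma cochNE f ws : (- f) ws = - f ws. Proof. by []. Qed.
Definition cochE := (cochDE, cochZE, cochNE).

Lemma parity_odd ws : parity ws = odd (size ws).
Proof. by elim: ws => //= w ws ->. Qed.

Definition multilinear f := forall us vs (a : K) x y,
  f (us ++ (a *: x + y) :: vs) = a *: f (us ++ x :: vs) + f (us ++ y :: vs).

Definition altern f := multilinear f /\ graded_sym xpredT xpredT f.

Lemma multilinear0 f us vs : multilinear f -> f (us ++ 0 :: vs) = 0.
Proof.
move=> /(_ us vs 1 0 0); rewrite !scale1r addr0.
by move=> /(congr1 (fun z => z - f (us ++ 0 :: vs))); rewrite subrr addrK.
Qed.

Lemma multilinear0_hd f ws : multilinear f -> f (0 :: ws) = 0.
Proof. exact: (@multilinear0 f [::]). Qed.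

Lemma altern0 : altern 0.
Proof.
have E ws : (0 : C) ws = 0 by [].
by split=> [us vs a x y | us x y vs _]; rewrite !E scaler0 ?addr0.
Qed.

Lemma altern_lin a f h : altern f -> altern h -> altern (a *: f + h).
Proof.
move=> [fl fs] [hl hs]; split=> [us vs b x y | us x y vs Sx]; rewrite !cochE.
  by rewrite fl hl !scalerDr !scalerA [b * a]mulrC addrACA.
by rewrite fs // hs // scalerDr !scalerA mulrC.
Qed.

(* NR_circ without its degree: Q vanishes on sequences of the wrong length, so
   that all splittings may be summed. *)
Definition circ P Q : C := fun ws => unsh ws (fun L R => P (Q L :: R)).

Lemma circ_linl a P P' Q : circ (a *: P + P') Q = a *: circ P Q + circ P' Q.
Proof.
by apply/funext => ws; rewrite !cochE /circ -unshZ -unshD; apply: eq_unsh => L R _;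
  rewrite !cochE.
Qed.

Lemma circ_linr a P Q Q' : multilinear P ->
  circ P (a *: Q + Q') = a *: circ P Q + circ P Q'.
Proof.
move=> Pl; apply/funext => ws; rewrite !cochE /circ -unshZ -unshD.
by apply: eq_unsh => L R _; rewrite !cochE (Pl [::]).
Qed.

Lemma circ0l Q : circ 0 Q = 0.
Proof. by apply/funext => ws; apply: unsh0P. Qed.

Lemma circ0r P : multilinear P -> circ P 0 = 0.
Proof. by move=> Pl; apply/funext => ws; apply: unsh0P => L R _;
  apply: multilinear0_hd. Qed.

Lemma altern_circ P Q : altern P -> altern Q -> altern (circ P Q).
Proof.
move=> [Pl Ps] [Ql Qs]; split=> [us vs a x y | us x y vs Sx].
  apply: (@unsh_mlin _ _ _ _ xpredT); rewrite ?all_predT // => us' vs' L _ _ _.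
    by rewrite Ql (Pl [::]).
  by rewrite -!cat_cons Pl.
apply: (@unsh_swap _ _ _ _ xpredT); rewrite ?all_predT // => us' vs' L _ _.
  by rewrite Qs ?all_predT // -[_ *: Q _]addr0 (Pl [::]) multilinear0_hd // addr0.
by rewrite -!cat_cons Ps // all_predT.
Qed.

(* q is the parity of the degree of Q, which is the arity minus one. *)
Definition homog_parity (q : bool) Q := forall ws, odd (size ws) = q -> Q ws = 0.

(* The terms of the composite where P and Q are both inserted in f; their
   graded symmetry is the pre-Lie identity, hence the Jacobi identity of br. *)
Definition circ2 f P Q : C := fun ws =>
  unsh ws (fun L S => unsh S (fun L' R => sgn (parity L') *: f (P L' :: Q L :: R))).

(** The value of [Q] goes either into [P] or directly into [f]; coassociativity regroups the first
    kind of terms. *)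
Lemma circ_assoc f P Q : multilinear f -> multilinear P ->
  circ (circ f P) Q = circ f (circ P Q) + circ2 f P Q.
Proof.
move=> fl Pl; apply/funext => ws; rewrite !cochE /circ /circ2.
have -> : unsh ws (fun L R => f (unsh L (fun L' R' => P (Q L' :: R')) :: R)) =
    unsh ws (fun L S => unsh S (fun L' R => f (P (Q L :: L') :: R))).
  rewrite -unsh_coassoc; apply: eq_unsh => L R _.
  by rewrite (@unsh_lin _ _ _ _ _ (fun w => f (w :: R))) // => a x y; apply: (fl [::]).
by rewrite -unshD.
Qed.

(** Cocommutativity exchanges the inputs of [P] and [Q], antisymmetry of [f] their outputs. The
    signs involve only the parities of the two arities, which are forced: other splittings give
    0. *)
Lemma circ2_sym f P Q p q : altern f -> homog_parity p P -> homog_parity q Q ->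
  circ2 f P Q = sgn (p && q) *: circ2 f Q P.
Proof.
move=> [fl fs] Pp Qq; apply/funext => ws; rewrite !cochE /circ2 -unshZ.
rewrite -(unsh_coassoc _ ws (fun L L' R => sgn (parity L') *: f (P L' :: Q L :: R))).
under [RHS]eq_unsh do rewrite -unshZ.
rewrite -(unsh_coassoc _ ws (fun L L' R => sgn (p && q) *: (sgn (parity L') *: f (Q L' ::
  P L :: R)))).
apply: eq_unsh => S R _; rewrite unsh_cocomm; apply: eq_unsh => L L' _.
have [PL|PL] := eqVneq (odd (size L)) p.
  by rewrite Pp // (multilinear0_hd _ fl) (@multilinear0 f [:: _]) // !scaler0.
have [QL|QL] := eqVneq (odd (size L')) q.
  by rewrite Qq // (multilinear0_hd _ fl) (@multilinear0 f [:: _]) // !scaler0.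
rewrite (fs [::]) ?all_predT // !parity_odd !scalerA -!signr_addb; congr (_ *: _).
by congr (sgn _); move: PL QL; do 2!case: odd; case: p Pp; case: q Qq.
Qed.

(** The Nijenhuis-Richardson bracket, with the degrees reduced to their parities; integer degrees of
    either sign are thus treated alike. *)
Definition br (p q : bool) P Q : C := circ P Q - sgn (p && q) *: circ Q P.

Lemma altern_br p q P Q : altern P -> altern Q -> altern (br p q P Q).
Proof.
move=> aP aQ; rewrite /br -scaleNr addrC; apply: altern_lin; exact: altern_circ.
Qed.

Lemma br_sym p q P Q : br p q P Q = - sgn (p && q) *: br q p Q P.
Proof.
rewrite /br scalerBr !scaleNr opprK scalerA andbC -signr_addb addbb scale1r.
by rewrite addrC.
Qed.

Lemma br_linl p q a P P' Q : multilinear Q ->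
  br p q (a *: P + P') Q = a *: br p q P Q + br p q P' Q.
Proof.
move=> Ql; rewrite /br circ_linl circ_linr // scalerBr scalerDr opprD.
by rewrite addrACA !scalerA mulrC.
Qed.

Lemma br_linr p q a P Q Q' : multilinear P ->
  br p q P (a *: Q + Q') = a *: br p q P Q + br p q P Q'.
Proof.
move=> Pl; rewrite /br circ_linl circ_linr // scalerBr scalerDr opprD.
by rewrite addrACA !scalerA mulrC.
Qed.

Lemma br0l p q Q : multilinear Q -> br p q 0 Q = 0.
Proof. by move=> Ql; rewrite /br circ0l circ0r // scaler0 subr0. Qed.

Lemma br0r p q P : multilinear P -> br p q P 0 = 0.
Proof. by move=> Ql; rewrite /br circ0l circ0r // scaler0 subr0. Qed.

(** The Jacobi identity as a derivation rule for bracketing with [N] on the right, the form that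
    iterated brackets need. After [circ_assoc], the nested composites cancel directly and the
    [circ2] terms by [circ2_sym]. *)
Lemma br_Jacobi p q r P Q N :
  altern P -> altern Q -> altern N ->
  homog_parity p P -> homog_parity q Q -> homog_parity r N ->
  br (p (+) q) r (br p q P Q) N =
  br p (q (+) r) P (br q r Q N) + sgn (q && r) *: br (p (+) r) q (br p r P N) Q.
Proof.
move=> aP aQ aN hP hQ hN; have [[Pl _] [Ql _] [Nl _]] := And3 aP aQ aN.
rewrite /br.
have L b X Y Z : circ (X - sgn b *: Y) Z = circ X Z - sgn b *: circ Y Z.
  by rewrite -!scaleNr addrC circ_linl addrC.
have Rr b X Y Z : multilinear X -> circ X (Y - sgn b *: Z) = circ X Y - sgn b *: circ X Z.
  by move=> Xl; rewrite -!scaleNr addrC circ_linr // addrC.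
rewrite !L !Rr // !circ_assoc //.
rewrite (circ2_sym aP hQ hN) (circ2_sym aQ hP hN) (circ2_sym aN hP hQ).
move: (circ P (circ Q N)) (circ P (circ N Q)) (circ Q (circ P N)) (circ Q (circ N P))
  (circ N (circ P Q)) (circ N (circ Q P)) (circ2 P N Q) (circ2 Q N P) (circ2 N Q P).
move=> t1 t2 t3 t4 t5 t6 t7 t8 t9.
case: p hP; case: q hQ; case: r hN => hN hQ hP; rewrite /= ?expr0 ?expr1 ?scale1r ?scaleN1r
  ?opprK ?scalerBr ?scalerDr ?opprB ?opprD ?scaleN1r; zmod_cancel.
Qed.

End Cochains.

(** * Bidegrees *)

Lemma odd_absz_add (m n : int) : odd `|m + n| = odd `|m| (+) odd `|n|.
Proof. lia. Qed.

Section Bidegree.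
Variables (K : fieldType) (charK0 : [pchar K] =i pred0) (g V : lmodType K).
Local Notation W := (g * V)%type.
Local Notation C := (cochain g V).
Local Notation sgn b := (sgn K b).
Implicit Types (f h P Q N : C) (ws us vs : seq W).

Lemma natr_inj_char0 : injective (fun n : nat => n%:R : K).
Proof.
have H m n : (m <= n)%N -> m%:R = n%:R :> K -> m = n.
  move=> mn /eqP; rewrite eq_sym -subr_eq0 -natrB //.
  by move/pcharf0P: charK0 => -> ?; lia.
by move=> m n; case: (leqP m n) => [/H//|/ltnW/H nm /esym/nm].
Qed.

Lemma exp2_inj_char0 : injective (fun n : nat => 2%:R ^+ n : K).
Proof. by move=> m n /=; rewrite -!natrX => /natr_inj_char0/expnI; apply. Qed.

Lemma two_neq0 : 2%:R != 0 :> K.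
Proof. by apply/eqP => /(@natr_inj_char0 2 0). Qed.

Lemma scale_exp2_eq (M : lmodType K) m n (x : M) :
  2%:R ^+ m *: x = 2%:R ^+ n *: x -> x = 0 \/ m = n.
Proof.
move/eqP; rewrite -subr_eq0 -scalerBl scaler_eq0 => /orP[|/eqP]; last by left.
by rewrite subr_eq0 => /eqP/exp2_inj_char0; right.
Qed.

Lemma multilinearD f us x y vs : multilinear f ->
  f (us ++ (x + y) :: vs) = f (us ++ x :: vs) + f (us ++ y :: vs).
Proof. by move=> /(_ us vs 1 x y); rewrite !scale1r. Qed.

(** Alternating and antisymmetric agree because 2 is invertible; towards alternating, a repeated
    entry is first moved next to its twin. *)
Lemma alt_homP m f :
  alt_hom m f <-> altern f /\ forall ws, size ws != m -> f ws = 0.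
Proof.
split=> [[f0 fl fa]|[[fl fs] f0]]; split=> //.
  split=> // us x y vs _; rewrite expr1 scaleN1r; apply/eqP; rewrite -addr_eq0; apply/eqP.
  have dup us' z vs' : f (us' ++ z :: z :: vs') = 0.
    by apply: fa; rewrite cat_uniq /= inE eqxx !andbF.
  have Dx := @multilinearD f (rcons us x) x y vs fl.
  have Dy := @multilinearD f (rcons us y) x y vs fl.
  rewrite !cat_rcons dup add0r in Dx; rewrite !cat_rcons dup addr0 in Dy.
  by rewrite -Dx -Dy -multilinearD.
move=> ws; suff dec : ~~ uniq ws -> exists us x vs ws', ws = us ++ x :: vs ++ x :: ws'.
  move=> /dec[us [x [vs [ws' ->]]]].
  rewrite -cat_rcons (graded_sym_move fs) ?all_predT // cat_rcons.
  suff -> : f (us ++ [:: x, x & vs ++ ws']) = 0 by rewrite scaler0.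
  have := fs us x x (vs ++ ws'); rewrite all_predT expr1 scaleN1r => /(_ isT)/eqP.
  rewrite -subr_eq0 opprK -mulr2n -scaler_nat scaler_eq0 (negPf two_neq0) /=.
  by move/eqP.
elim: ws => //= x ws IH; rewrite negb_and negbK => /orP[|/IH].
  by case/splitPr => vs ws'; exists [::], x, vs, ws'.
by move=> [us [y [vs [ws' ->]]]]; exists (x :: us), y, vs, ws'.
Qed.

Lemma NR_circE q P Q : multilinear P -> (forall ws, size ws != q.+1 -> Q ws = 0) ->
  NR_circ q P Q = circ P Q.
Proof.
move=> Pl Q0; apply/funext => ws; rewrite /NR_circ /circ.
(* On shorter sequences [sum_shuffle] does not apply, but every left part is too short for [Q], so
   both sides are 0. *)
have [ltwq|lqw] := ltnP (size ws) q.+1.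
  rewrite big1 => [|s _]; last first.
    rewrite Q0 ?multilinear0_hd ?scaler0 // size_take_min size_map size_enum_ord.
    by rewrite neq_ltn gtn_min ltwq orbT.
  symmetry; apply: unsh0P => L R /splitting_size sz.
  by rewrite Q0 ?multilinear0_hd //; apply/eqP; lia.
have := @sum_shuffle K W (fun => true) W (size ws) q.+1 (tnth (in_tuple ws))
  (fun L R => P (Q L :: R)) lqw.
rewrite map_tnth_enum /=.
under eq_bigr do rewrite koszul_odd.
move=> ->; apply: eq_unsh => L R _; case: eqP => // /eqP LR.
by rewrite Q0 // multilinear0_hd.
Qed.

(** On C^{k|l}, scaling the arguments multiplies g-values by 2^l and V-values by 2^(l+1). Scaling
    the value too absorbs the extra 2, so both components obey one law. *)
Definition weight_scaling (w : W) : W := (w.1, 2%:R *: w.2).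
Local Notation phi := weight_scaling.

(* Since 2 has infinite multiplicative order in K, having V-weight l detects
   the second index of the bidegree. *)
Definition has_weight (l : nat) f := forall ws,
  f (map phi ws) = 2%:R ^+ l *: phi (f ws).

Definition supported (d : int) f := forall ws, (size ws)%:Z != d + 1 -> f ws = 0.

(** Describes C^{k|l} with k = [d] - [l], in coordinates that add under composition. The degree [d]
    is an integer so that zero components of negative degree are included. *)
Definition bihomog (d : int) (l : nat) f := [/\ altern f, supported d f & has_weight l f].

Lemma phi_lin a x y : phi (a *: x + y) = a *: phi x + phi y.
Proof.
rewrite /phi; congr pair => /=.
by rewrite scalerDr !scalerA mulrC.
Qed.

Lemma phi0 : phi 0 = 0.
Proof. by rewrite /phi; congr pair; rewrite /= scaler0. Qed.

Lemma phiZ a x : phi (a *: x) = a *: phi x.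
Proof. by rewrite -[a *: x]addr0 phi_lin phi0 addr0. Qed.

Lemma multilinearZ f us a x vs : multilinear f ->
  f (us ++ (a *: x) :: vs) = a *: f (us ++ x :: vs).
Proof. by move=> fl; rewrite -[a *: x]addr0 fl multilinear0 // addr0. Qed.

Lemma bihomog_altern d l f : bihomog d l f -> altern f.
Proof. by case. Qed.

Lemma bihomog_ml d l f : bihomog d l f -> multilinear f.
Proof. by case=> [[]]. Qed.

Lemma bihomog_parity d l f : bihomog d l f -> homog_parity (odd `|d|) f.
Proof. by move=> [_ f0 _] ws E; apply: f0; apply/eqP; lia. Qed.

Lemma bihomog0 d l : bihomog d l 0.
Proof.
split; [exact: altern0 | by [] | move=> ws].
by change (0 = 2%:R ^+ l *: phi 0); rewrite phi0 scaler0.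
Qed.

Lemma bihomog_lin d l a f h : bihomog d l f -> bihomog d l h -> bihomog d l (a *: f + h).
Proof.
move=> [fa f0 fw] [ha h0 hw]; split; first exact: altern_lin.
  by move=> ws wsd; rewrite !cochE f0 // h0 // scaler0 addr0.
by move=> ws; rewrite !cochE fw hw phi_lin scalerDr !scalerA mulrC.
Qed.

Lemma unsh_map (X Y : Type) (par : Y -> bool) (t : X -> Y) (M : lmodType K) xs
  (F : seq Y -> seq Y -> M) :
  unsh par (map t xs) F = unsh (par \o t) xs (fun L R => F (map t L) (map t R)).
Proof.
elim: xs F => //= x xs IH F; rewrite !IH /=; congr (_ + _).
apply: eq_unsh => L R _; congr (sgn (_ && _) *: _).
by elim: L => //= ? ? ->.
Qed.

Lemma bihomog_circ d l d' l' P Q :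
  bihomog d l P -> bihomog d' l' Q -> bihomog (d + d') (l + l') (circ P Q).
Proof.
move=> [Pa P0 Pw] [Qa Q0 Qw]; have Pl := Pa.1; split; first exact: altern_circ.
  move=> ws wsd; apply: unsh0P => L R /splitting_size sz.
  have [sL|/Q0 ->] := eqVneq (size L)%:Z (d' + 1); last exact: multilinear0_hd.
  by apply: P0; apply/eqP => /= sR; move/eqP: wsd; apply; lia.
move=> ws; rewrite /circ unsh_map.
rewrite (@unsh_lin _ _ _ _ _ phi); last exact: phi_lin.
rewrite -unshZ; apply: eq_unsh => L R _.
by rewrite Qw (@multilinearZ P [::]) // -[phi _ :: _]/(map phi (Q L :: R)) Pw scalerA
  exprD mulrC.
Qed.

Lemma bihomog_br d l d' l' p q P Q :
  bihomog d l P -> bihomog d' l' Q -> bihomog (d + d') (l + l') (br p q P Q).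
Proof.
move=> hP hQ; rewrite /br -scaleNr [X in bihomog _ _ X]addrC.
apply: bihomog_lin; last exact: bihomog_circ.
by rewrite addrC addnC; apply: bihomog_circ.
Qed.

Definition inl0 (x : g) : W := (x, 0).
Definition inr0 (v : V) : W := (0, v).

(** Each argument is split into its g and V parts, and antisymmetry moves these into a growing
    prefix of pure arguments, g before V. *)
Lemma altern_eq0 f : altern f ->
  (forall xs (vs : seq V), f (map inl0 xs ++ map inr0 vs) = 0) -> f = 0.
Proof.
move=> [fl fs] f0; apply/funext => ws.
suff H xs (vs : seq V) : f (map inl0 xs ++ map inr0 vs ++ ws) = 0 by exact: (H [::] [::]).
elim: ws xs vs => [|w ws IH] xs vs; first by rewrite cats0.
have -> : w = 1 *: inl0 w.1 + inr0 w.2.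
  by rewrite scale1r; case: w => x v; rewrite /inl0 /inr0; congr pair;
    rewrite /= ?addr0 ?add0r.
rewrite catA fl scale1r -!catA (graded_sym_move fs) ?all_predT //.
rewrite -cat_rcons -map_rcons IH scaler0 add0r.
by rewrite -[X in _ ++ X]cat_rcons -map_rcons IH.
Qed.

Lemma map_phi_pure xs (vs : seq V) :
  map phi (map inl0 xs ++ map inr0 vs) = map inl0 xs ++ map inr0 (map ( *:%R 2%:R) vs).
Proof.
rewrite map_cat -!map_comp; congr (_ ++ _).
by apply: eq_map => x; rewrite /= /phi /inl0 /= scaler0.
Qed.

Lemma multilinear_phi f xs (vs : seq V) : multilinear f ->
  f (map phi (map inl0 xs ++ map inr0 vs)) =
  2%:R ^+ size vs *: f (map inl0 xs ++ map inr0 vs).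
Proof.
move=> fl; rewrite map_phi_pure; move: (map inl0 xs) => us.
elim: vs us => [|v vs IH] us /=; first by rewrite scale1r.
have -> : inr0 (2%:R *: v) = 2%:R *: inr0 v.
  by rewrite /inr0; congr pair => /=; rewrite scaler0.
by rewrite multilinearZ // -[X in _ *: f X = _]cat_rcons IH cat_rcons scalerA exprS.
Qed.

(** Scaling pure arguments gives a factor 2 for each entry of [vs], while the weight law gives 2^l
    on g-values and 2^(l+1) on V-values; a nonzero value forces the exponents to agree. *)
Lemma bihomog_pure d l f xs (vs : seq V) : bihomog d l f ->
  let w := f (map inl0 xs ++ map inr0 vs) in
  (w.1 <> 0 -> size vs = l /\ (size xs)%:Z = d - l%:Z + 1) /\
  (w.2 <> 0 -> size vs = l.+1 /\ (size xs)%:Z = d - l%:Z).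
Proof.
move=> [[fl fs] f0 fw] w.
have sz : w <> 0 -> (size xs + size vs)%:Z = d + 1.
  by move=> w0; apply/eqP; apply: contra_notT w0 => w0; rewrite /w f0 // size_cat !size_map.
have E : 2%:R ^+ size vs *: w = 2%:R ^+ l *: phi w.
  by rewrite /w -multilinear_phi // fw.
split=> w0.
  have /(congr1 fst)/= := E => /scale_exp2_eq[//|vl].
  by have : (size xs + size vs)%:Z = d + 1; [apply: sz => /(congr1 fst) | lia].
have /(congr1 snd)/= := E; rewrite scalerA -exprSr => /scale_exp2_eq[//|vl].
by have : (size xs + size vs)%:Z = d + 1; [apply: sz => /(congr1 snd) | lia].
Qed.

Lemma bidegreeP (k : int) (l m : nat) f : m%:Z = k + l%:Z + 1 ->
  bidegree k l f <-> bihomog (k + l%:Z) l f.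
Proof.
move=> mkl; split.
  move=> [m' [m'kl /alt_homP[fa f0] fb]]; split=> //.
    by move=> ws wsd; apply: f0; move: wsd; rewrite -m'kl.
  move=> ws; apply/eqP; rewrite -subr_eq0; apply/eqP.
  (* The defect of the weight law is again multilinear and antisymmetric, so it may be tested on
     pure arguments. *)
  pose h : C := fun ws => f (map phi ws) - 2%:R ^+ l *: phi (f ws).
  suff h0 : h = 0 by rewrite -[LHS]/(h ws) h0.
  have [fl fs] := fa.
  apply: altern_eq0 => [|xs vs].
    split=> [us vs a x y | us x y vs _]; rewrite /h !map_cat /=.
      by rewrite phi_lin !fl phi_lin !scalerDr !scalerN !scalerA mulrC opprD addrACA.
    rewrite (fs (map phi us) (phi x)) ?all_predT // (fs us x) ?all_predT //.
    by rewrite phiZ scalerBr !scalerA mulrC.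
  rewrite /h multilinear_phi //.
  have [w1 w2] := fb xs vs; set w := f _ in w1 w2 *.
  apply/eqP; rewrite subr_eq0; apply/eqP; rewrite [LHS]surjective_pairing; congr pair => /=.
    have [->//|nl] := eqVneq (size vs) l.
    by rewrite w1 ?scaler0 // => -[_ [E]]; rewrite E eqxx in nl.
  rewrite scalerA -exprSr; have [->//|nl] := eqVneq (size vs) l.+1.
  rewrite w2 ?scaler0 // => -[_ E]; move/eqP: nl; apply; lia.
move=> hf; have [fa f0 fw] := hf; exists m; split=> //.
  by apply/alt_homP; split=> // ws wsm; apply: f0; rewrite -mkl.
move=> xs vs w; have [w1 w2] := bihomog_pure xs vs hf.
split=> H; apply/eqP; apply: contra_notT H => /eqP.
  by move=> /w1[-> ->]; split; lia.
by move=> /w2[-> ->]; split; lia.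
Qed.

Lemma bihomog_eq0 d l f : bihomog d l f -> d - l%:Z < -1 -> f = 0.
Proof.
move=> hf dl; apply: altern_eq0 => [|xs vs]; first exact: bihomog_altern hf.
have [w1 w2] := bihomog_pure xs vs hf; set w := f _ in w1 w2 *.
rewrite [w]surjective_pairing; congr pair; apply/eqP/negP => /negP/eqP.
  by move/w1 => []; lia.
by move/w2 => []; lia.
Qed.

Lemma altern_proj f : altern f -> altern (proj_h f).
Proof.
move=> [fl fs]; split=> [us vs a x y | us x y vs _]; rewrite /proj_h !map_cat /=.
  have -> : (0, a *: x.2 + y.2) = a *: (0, x.2) + (0, y.2) :> W.
    by congr pair => /=; rewrite scaler0 addr0.
  by rewrite fl; congr pair => /=; rewrite scaler0 addr0.
by rewrite fs ?all_predT //; congr pair => /=; rewrite scaler0.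
Qed.

(** [proj_h] replaces the g-parts of the arguments by 0, which by multilinearity kills all values
    with an argument in g; among bihomogeneous maps only k = -1 survives. *)
Lemma proj_h_bihomog d l f : bihomog d l f ->
  proj_h f = if d - l%:Z == -1 then f else 0.
Proof.
move=> hf; have fa := bihomog_altern hf.
apply/eqP; rewrite -subr_eq0; apply/eqP; apply: altern_eq0 => [|xs vs].
  rewrite addrC -scaleN1r; apply: altern_lin; last exact: altern_proj.
  by case: ifP => _ //; apply: altern0.
rewrite !cochDE cochNE; have [w1 w2] := bihomog_pure xs vs hf.
have E : map (fun w : W => (0 : g, w.2)) (map inl0 xs ++ map inr0 vs) =
    map inl0 (nseq (size xs) 0) ++ map inr0 vs.
  by rewrite map_cat -!map_comp; congr (_ ++ _); elim: xs {w1 w2} => //= ? ? ->.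
case: eqP => dl.
  case: xs w1 w2 E => [|x xs] w1 w2 E; rewrite /proj_h E.
    rewrite [X in _ - X]surjective_pairing; congr pair => /=; first by rewrite subrr.
    by apply/eqP; rewrite sub0r oppr_eq0; apply/negP => /negP/eqP/w2[]; lia.
  rewrite /= multilinear0_hd; last exact: fa.1.
  rewrite [X in _ - X](_ : _ = 0) ?subr0 //.
  rewrite [LHS]surjective_pairing; congr pair; apply/eqP/negP => /negP/eqP.
    by move/w1 => [] /=; lia.
  by move/w2 => [] /=; lia.
rewrite subr0 /proj_h E; congr pair.
case: xs {w1 w2 E} => [|x xs] /=; last by rewrite multilinear0_hd //; exact: fa.1.
apply/eqP/negP => /negP/eqP; have [w1 _] := bihomog_pure [::] vs hf.
by move/w1 => [_ /=]; lia.
Qed.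

Lemma proj_h0 : proj_h 0 = 0 :> C.
Proof. by apply/funext. Qed.

Lemma proj_h_lin a f h : proj_h (a *: f + h) = a *: proj_h f + proj_h h.
Proof.
apply/funext => ws; rewrite !cochE /proj_h; congr pair => /=.
by rewrite scaler0 addr0.
Qed.

(* This holds because h is an abelian subalgebra and the kernel of the
   projection is a subalgebra. *)
Lemma proj_h_br d l d' l' p q f h : bihomog d l f -> bihomog d' l' h ->
  proj_h (br p q f h) = proj_h (br p q (proj_h f) h) + proj_h (br p q f (proj_h h)).
Proof.
move=> hf hh; have hfh := bihomog_br p q hf hh.
have fl := bihomog_ml hf; have hl := bihomog_ml hh.
have [/(bihomog_eq0 hf) f0|fk] := ltP (d - l%:Z) (-1).
  by rewrite f0 proj_h0 !br0l // ?proj_h0 ?addr0 //;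
    case: (altern_proj (bihomog_altern hh)).
have [/(bihomog_eq0 hh) h0|hk] := ltP (d' - l'%:Z) (-1).
  by rewrite h0 proj_h0 !br0r // ?proj_h0 ?addr0 //;
    case: (altern_proj (bihomog_altern hf)).
rewrite (proj_h_bihomog hf) (proj_h_bihomog hh).
case: eqP => f1; case: eqP => h1; rewrite ?br0l ?br0r // ?proj_h0 ?addr0 ?add0r //.
  by rewrite (bihomog_eq0 hfh) ?proj_h0 ?addr0 //; lia.
by rewrite (proj_h_bihomog hfh); case: eqP => // E; lia.
Qed.

End Bidegree.

(** * The L-infinity algebra *)

Lemma exprN1z (K : fieldType) (n : int) : (-1 : K) ^ n = sgn K (odd `|n|).
Proof.
case: n => n; first by rewrite -[LHS]signr_odd.
by rewrite NegzE -exprz_inv invrN1 -[LHS]signr_odd abszN.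
Qed.

Section DegreeParity.
Variables (K : fieldType) (M : lmodType K).

Definition odd_degree (x : int * M) : bool := odd `|x.1|.

Lemma parity_total_degree (xs : seq (int * M)) :
  parity_by odd_degree xs = odd `|total_degree xs|.
Proof.
rewrite /total_degree; elim: xs => [|x xs IH]; first by rewrite big_nil.
by rewrite big_cons odd_absz_add -IH.
Qed.

Definition homog_in (E : int -> set M) (x : int * M) : bool := `[< E x.1 x.2 >].

Lemma homog_inP (E : int -> set M) (x : int * M) : reflect (E x.1 x.2) (homog_in E x).
Proof. exact: asboolP. Qed.

Lemma homogeneous_all (E : int -> set M) (xs : seq (int * M)) :
  homogeneous E xs <-> all (homog_in E) xs.
Proof.
by split=> [H|/allP H]; [apply/allP => x /H/homog_inP | move=> x /H/homog_inP].
Qed.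

End DegreeParity.

Section UnshuffleOne.
Variables (K : comPzRingType) (X : Type) (par : X -> bool) (M : lmodType K).

Lemma unsh_nil xs (H : seq X -> M) :
  unsh par xs (fun L R => if L is [::] then H R else 0) = H xs.
Proof.
elim: xs H => //= x xs IH H; rewrite unsh0 add0r -(IH (fun R => H (x :: R))).
by apply: eq_unsh => -[|y L] R _; rewrite ?andbF ?scale1r ?scaler0.
Qed.

(** Splitting off one entry amounts to choosing an index, with the sign of moving it to the front:
    the form of the sum in [l_op]. *)
Lemma unsh_one xs (G : X -> seq X -> M) :
  unsh par xs (fun L R => if L is [:: x] then G x R else 0) =
  \sum_(i < size xs) sgn K (par (tnth (in_tuple xs) i) && parity_by par (take i xs)) *:
    G (tnth (in_tuple xs) i) (take i xs ++ drop i.+1 xs).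
Proof.
elim: xs G => [|x xs IH] G; first by rewrite big_ord0.
rewrite /= unsh_nil big_ord_recl /= andbF scale1r drop0; congr (_ + _).
pose G' y R := sgn K (par x && par y) *: G y (x :: R).
transitivity (unsh par xs (fun L R => if L is [:: y] then G' y R else 0)).
  by apply: eq_unsh => -[|y [|z L]] R _; rewrite ?scaler0 //= addbF.
rewrite IH; apply: eq_bigr => i _.
rewrite /G' !(tnth_nth x) /= scalerA -signr_addb; congr (sgn K _ *: _).
by case: (par x); case: (par _); case: (parity_by _ _).
Qed.

Lemma unsh_exchange (Y : Type) (par' : Y -> bool) xs ys
  (F : seq X -> seq X -> seq Y -> seq Y -> M) :
  unsh par xs (fun A B => unsh par' ys (fun C D => F A B C D)) =
  unsh par' ys (fun C D => unsh par xs (fun A B => F A B C D)).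
Proof.
elim: ys F => //= y ys IH F; rewrite unshD !IH; congr (_ + _).
by apply: eq_unsh => C D _; rewrite unshZ.
Qed.

End UnshuffleOne.

Section Operations.
Variables (K : fieldType) (charK0 : [pchar K] =i pred0) (g V : lmodType K).
Local Notation C := (cochain g V).
Local Notation X := (int * (C * C))%type.
Local Notation sgn b := (sgn K b).
Local Notation par := (@odd_degree K (C * C)%type).
Local Notation parity := (parity_by par).
Local Notation unsh := (unsh (K := K) par).
Local Notation homog := (homog_in (@sL'_h K g V)).
Implicit Types (f h P Q N : C) (xs us vs L R A B : seq X) (x y z : X).

(** The clause on negative [n] is not automatic: in degree -1 a bihomogeneous map may be a constant
    in g. *)
Lemma L'_spaceP n f : L'_space n f <-> bihomog n 0 f /\ (n < 0 -> f = 0).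
Proof.
case: n => n /=.
  have := @bidegreeP _ charK0 _ _ n 0 n.+1 f; rewrite !addr0 => -> //; last by lia.
  by split=> [H|[]//]; split=> // H'; lia.
by split=> [->|[_ H]]; [split=> //; apply: bihomog0 | apply: H; lia].
Qed.

Lemma h_spaceP n f : h_space n f <-> bihomog n `|n + 1| f /\ (n < 0 -> f = 0).
Proof.
case: n => n /=.
  rewrite (_ : n%:Z + 1 = n.+1%:Z); last by lia.
  rewrite (@bidegreeP _ charK0 _ _ _ _ n.+1); last by lia.
  rewrite (_ : -1 + n.+1%:Z = n%:Z) ?addn1; last by lia.
  by split=> [H|[]//]; split=> // H'; lia.
by split=> [->|[_ H]]; [split=> //; apply: bihomog0 | apply: H; lia].
Qed.

Lemma homog_L' x : homog x -> bihomog (x.1 + 1) 0 x.2.1.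
Proof. by move/homog_inP => [/L'_spaceP[]]. Qed.

Lemma homog_L'0 x : homog x -> x.1 + 1 < 0 -> x.2.1 = 0.
Proof. by move/homog_inP => [/L'_spaceP[]]. Qed.

Lemma homog_h x : homog x -> bihomog x.1 `|x.1 + 1| x.2.2.
Proof. by move/homog_inP => [_ /h_spaceP[]]. Qed.

Lemma homog_h0 x : homog x -> x.1 < 0 -> x.2.2 = 0.
Proof. by move/homog_inP => [_ /h_spaceP[]]. Qed.

(* [...[[Q, t_1], t_2], ..., t_k] for the components t_i in h of R; only the
   parity p of the degree of Q matters. *)
Fixpoint iter_br (p : bool) Q R : C :=
  if R is y :: R' then iter_br (p (+) par y) (br p (par y) Q y.2.2) R' else Q.

Lemma iter_br_cat p Q A B :
  iter_br p Q (A ++ B) = iter_br (p (+) parity A) (iter_br p Q A) B.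
Proof. by elim: A p Q => [|x A IH] p Q /=; rewrite ?addbF // IH addbA. Qed.

Lemma iter_br_lin p a Q Q' R : all homog R ->
  iter_br p (a *: Q + Q') R = a *: iter_br p Q R + iter_br p Q' R.
Proof.
elim: R p Q Q' => //= y R IH p Q Q' /andP[/homog_h/bihomog_ml yl SR].
by rewrite br_linl // IH.
Qed.

Lemma iter_brZ p a Q R : all homog R -> iter_br p (a *: Q) R = a *: iter_br p Q R.
Proof.
elim: R p Q => //= y R IH p Q /andP[/homog_h/bihomog_ml yl SR].
by rewrite -[a *: Q]addr0 br_linl // br0l // addr0 IH.
Qed.

Lemma iter_br0 p R : all homog R -> iter_br p 0 R = 0.
Proof. by move=> SR; rewrite -(scale0r (0 : C)) iter_brZ // !scale0r. Qed.

Lemma iter_br_bihomog p d l Q R : bihomog d l Q -> all homog R ->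
  bihomog (d + \sum_(y <- R) y.1) (l + \sum_(y <- R) `|(y.1 + 1)%R|)%N (iter_br p Q R).
Proof.
elim: R p d l Q => [|y R IH] p d l Q hQ; first by rewrite !big_nil addr0 addn0.
rewrite !big_cons addrA addnA => /andP[/homog_h hy SR].
by apply: IH => //; apply: bihomog_br.
Qed.

(** Lets degree counts assume nonnegative degrees, where the weight [|y.1 + 1|] in [iter_br_bihomog]
    is y.1 + 1. *)
Lemma iter_br_neg p Q R : all homog R -> altern Q ->
  iter_br p Q R = 0 \/ all (fun y : X => 0 <= y.1) R.
Proof.
elim: R p Q => [|y R IH] p Q /=; first by right.
move=> /andP[hy SR] aQ; have ay := bihomog_altern (homog_h hy).
have [y0|y0] := ltP y.1 0.
  by left; rewrite (homog_h0 hy y0) br0r ?iter_br0 //; case: aQ.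
by apply: IH => //; apply: altern_br.
Qed.

Lemma br_homog_h p q x y : homog x -> homog y -> br p q x.2.2 y.2.2 = 0.
Proof.
move=> hx hy; have hhx := homog_h hx; have hhy := homog_h hy.
have [/(homog_h0 hx) ->|x0] := ltP x.1 0; first by rewrite br0l //; apply: bihomog_ml hhy.
have [/(homog_h0 hy) ->|y0] := ltP y.1 0; first by rewrite br0r //; apply: bihomog_ml hhx.
by apply: (bihomog_eq0 charK0 (bihomog_br p q hhx hhy)); lia.
Qed.

(** By the Jacobi identity, exchanging adjacent arguments costs a bracket of two elements of h,
    which is 0. *)
Lemma iter_br_sym d l Q : bihomog d l Q ->
  graded_sym par homog (iter_br (odd `|d|) Q).
Proof.
move=> hQ us x y vs; rewrite all_cat /= => /and4P[Sus hx hy Svs].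
rewrite !iter_br_cat /=; set p := odd `|d| (+) parity us; set P := iter_br _ _ us.
have hP := iter_br_bihomog (odd `|d|) hQ Sus.
have hPp : homog_parity p P.
  by rewrite /p parity_total_degree -odd_absz_add; exact: (bihomog_parity hP).
have hhx := homog_h hx; have hhy := homog_h hy.
rewrite br_Jacobi //.
- rewrite br_homog_h // br0r ?add0r; last exact: bihomog_ml hP.
  by rewrite iter_brZ // addbAC.
- exact: bihomog_altern hP.
- exact: bihomog_altern hhx.
- exact: bihomog_altern hhy.
- exact: bihomog_parity hhx.
exact: bihomog_parity hhy.
Qed.

(** Iterated Leibniz rule: each bracket with an entry of [R] falls on [P] or on [Q], hence a sum
    over splittings of [R]. *)
Lemma iter_br_derivation d l d' l' P Q R : bihomog d l P -> bihomog d' l' Q ->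
  all homog R ->
  let p := odd `|d| in let q := odd `|d'| in
  iter_br (p (+) q) (br p q P Q) R =
  unsh R (fun A B => sgn (q && parity A) *:
    br (p (+) parity A) (q (+) parity B) (iter_br p P A) (iter_br q Q B)).
Proof.
move=> hP hQ SR p q; rewrite {}/p {}/q.
elim: R d l d' l' P Q hP hQ SR => [|y R IH] d l d' l' P Q hP hQ /=.
  by rewrite andbF scale1r !addbF.
case/andP=> hy SR; have hhy := homog_h hy.
rewrite br_Jacobi; first last.
- exact: bihomog_parity hhy.
- exact: bihomog_parity hQ.
- exact: bihomog_parity hP.
- exact: bihomog_altern hhy.
- exact: bihomog_altern hQ.
- exact: bihomog_altern hP.
rewrite addrC iter_br_lin //; congr (_ + _).
  have hPy := bihomog_br (odd `|d|) (par y) hP hhy.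
  have := IH _ _ _ _ _ _ hPy hQ SR; rewrite odd_absz_add -/(par y).
  rewrite addbAC => ->; rewrite -unshZ; apply: eq_unsh => A B _.
  rewrite scalerA -signr_addb -!addbA; congr (sgn _ *: _).
  by case: (odd _); case: (par y); case: (parity A).
have hQy := bihomog_br (odd `|d'|) (par y) hQ hhy.
have := IH _ _ _ _ _ _ hP hQy SR; rewrite odd_absz_add -/(par y).
rewrite addbA => ->; apply: eq_unsh => A B _.
rewrite scalerA -signr_addb -!addbA; congr (sgn _ *: _).
by case: (odd _); case: (par y); case: (parity A).
Qed.

(** This and the next three definitions restate [l_op] through [br] and [unsh]. The parity in L' is
    [~~ par x] because of the shift by s^{-1}. *)
Definition op_h1 x R : C := proj_h (iter_br (~~ par x) x.2.1 R).

Definition op_L' xs : C :=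
  if xs is [:: x; y] then sgn (~~ par x) *: br (~~ par x) (~~ par y) x.2.1 y.2.1 else 0.

Definition op_h xs : C := unsh xs (fun L R => if L is [:: x] then op_h1 x R else 0).

Definition op xs : C * C := (op_L' xs, op_h xs).

Lemma NR_bracketE m l n l' P Q :
  bihomog m%:Z l P -> bihomog n%:Z l' Q ->
  (NR_bracket (m, P) (n, Q)).2 = br (odd m) (odd n) P Q.
Proof.
move=> hP hQ; rewrite /NR_bracket /= /br.
rewrite !NR_circE; try exact: bihomog_ml hP; try exact: bihomog_ml hQ.
- by rewrite -oddM signr_odd.
- by case: hP => _ H _ ws wsm; apply: H; apply/eqP; lia.
by case: hQ => _ H _ ws wsm; apply: H; apply/eqP; lia.
Qed.

Lemma foldl_NR_bracketE n l Q R : bihomog n%:Z l Q -> all homog R ->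
  (foldl (@NR_bracket K g V) (n, Q) (map (@h_part K g V) R)).2 = iter_br (odd n) Q R.
Proof.
elim: R n l Q => [|y R IH] n l Q hQ //= /andP[hy SR].
(* [h_part] records the absolute value of the degree; where it differs from the degree, the
   component is 0. *)
have hy' : bihomog `|y.1|%N%:Z `|y.1 + 1| y.2.2.
  have [y0|y0] := ltP y.1 0; first by rewrite (homog_h0 hy y0); apply: bihomog0.
  by rewrite gez0_abs //; apply: homog_h.
rewrite [NR_bracket _ _]surjective_pairing (NR_bracketE hQ hy') /=.
rewrite (IH _ (l + `|(y.1 + 1)%R|)%N) ?oddD //.
by rewrite PoszD; apply: bihomog_br.
Qed.

Lemma odd_absz_succ (n : int) : odd `|n + 1| = ~~ odd `|n|.
Proof. lia. Qed.

Lemma homog_L'_abs x : homog x -> bihomog `|(x.1 + 1)%R|%N%:Z 0 x.2.1.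
Proof.
move=> hx; have [x0|x0] := ltP (x.1 + 1) 0; first by rewrite (homog_L'0 hx x0);
  apply: bihomog0.
by rewrite gez0_abs //; apply: homog_L'.
Qed.

Lemma l_opE xs : all homog xs -> l_op xs = op xs.
Proof.
move=> Sxs; congr pair.
  case: xs Sxs => [|x [|y [|z xs]]] //= /and3P[hx hy _].
  transitivity ((-1 : K) ^+ (L'_part x).1 *: (NR_bracket (L'_part x) (L'_part y)).2) => //.
  rewrite (NR_bracketE (homog_L'_abs hx) (homog_L'_abs hy)) -[in LHS]signr_odd.
  by rewrite !odd_absz_succ.
rewrite /op_h unsh_one; apply: eq_bigr => i _.
have hi : homog (tnth (in_tuple xs) i) by apply: (allP Sxs);
  apply: (mem_tnth i (in_tuple xs)).
rewrite exprN1z abszM oddM -parity_total_degree; congr (_ *: _).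
rewrite /derived_bracket /op_h1 /L'_part (foldl_NR_bracketE (homog_L'_abs hi)).
  by rewrite odd_absz_succ.
have : all homog (take i xs ++ drop i xs) by rewrite cat_take_drop.
by rewrite (drop_nth (tnth (in_tuple xs) i)) // !all_cat /= => /and3P[-> _ ->].
Qed.

End Operations.

(** * Degree, multilinearity and graded symmetry of the operations *)

Section OperationSymmetry.
Variables (K : fieldType) (charK0 : [pchar K] =i pred0) (g V : lmodType K).
Local Notation C := (cochain g V).
Local Notation X := (int * (C * C))%type.
Local Notation sgn b := (sgn K b).
Local Notation par := (@odd_degree K (C * C)%type).
Local Notation parity := (parity_by par).
Local Notation homog := (homog_in (@sL'_h K g V)).
Implicit Types (f h P Q N : C) (xs us vs L R A B : seq X) (x y z : X).

Lemma L'_space0 n : @L'_space K g V n 0.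
Proof. by apply/(L'_spaceP charK0); split=> //; apply: bihomog0. Qed.

Lemma h_space0 n : @h_space K g V n 0.
Proof. by apply/(h_spaceP charK0); split=> //; apply: bihomog0. Qed.

Lemma L'_space_lin n a f h : L'_space n f -> L'_space n h -> L'_space n (a *: f + h).
Proof.
move=> /(L'_spaceP charK0)[hf f0] /(L'_spaceP charK0)[hh h0].
apply/(L'_spaceP charK0); split=> [|n0]; first exact: bihomog_lin.
by rewrite f0 // h0 // scaler0 addr0.
Qed.

Lemma h_space_lin n a f h : h_space n f -> h_space n h -> h_space n (a *: f + h).
Proof.
move=> /(h_spaceP charK0)[hf f0] /(h_spaceP charK0)[hh h0].
apply/(h_spaceP charK0); split=> [|n0]; first exact: bihomog_lin.
by rewrite f0 // h0 // scaler0 addr0.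
Qed.

Lemma graded_sL'_h : is_graded_space (@sL'_h K g V).
Proof.
move=> d; split; first by split; [apply: L'_space0 | apply: h_space0].
by move=> a x y [Lx hx] [Ly hy]; split; [apply: L'_space_lin | apply: h_space_lin].
Qed.

Lemma splitting_homog xs L R : splitting xs L R -> all homog xs ->
  all homog L /\ all homog R.
Proof. by move=> s; rewrite (splitting_all _ s) => /andP. Qed.

Lemma sum_absz_succ R : all (fun y : X => 0 <= y.1) R ->
  (\sum_(y <- R) `|(y.1 + 1)%R|)%N%:Z = \sum_(y <- R) y.1 + (size R)%:Z.
Proof.
elim: R => [|y R IH]; first by rewrite !big_nil.
rewrite !big_cons /= => /andP[y0 /IH {IH}].
by set s := \sum_(z <- R) z.1; set t := (\sum_(z <- R) `|(z.1 + 1)%R|)%N => E; lia.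
Qed.

Lemma op_h1_space x R : homog x -> all homog R ->
  h_space (x.1 + total_degree R + 1) (op_h1 x R).
Proof.
move=> hx SR; have hQ := homog_L' charK0 hx.
have hI := iter_br_bihomog charK0 (~~ par x) hQ SR.
rewrite /op_h1 (proj_h_bihomog charK0 hI); case: eqP => [E|_]; last exact: h_space0.
have [->|pos] := iter_br_neg charK0 (~~ par x) SR (bihomog_altern hQ);
  first exact: h_space0.
have Rsum := sum_absz_succ pos.
have sum_ge0 : 0 <= \sum_(y <- R) y.1.
  by rewrite big_seq; apply: sumr_ge0 => y yR; apply: (allP pos).
(* Without arguments from h, first index -1 means x.1 + 1 = -1, a negative degree of L', where the
   component is 0. *)
case: R SR hI E Rsum pos sum_ge0 => [|y R] SR hI E Rsum pos sum_ge0.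
  rewrite /= (homog_L'0 charK0 hx); first exact: h_space0.
  by move: E; rewrite !big_nil; lia.
apply/(h_spaceP charK0); move: hI E Rsum sum_ge0; rewrite /total_degree /=.
set s := \sum_(z <- y :: R) z.1;
  set t := (\sum_(z <- y :: R) `|(z.1 + 1)%R|)%N => hI E Rsum sum_ge0.
split; last by lia.
rewrite (_ : x.1 + s + 1 = x.1 + 1 + s); last by lia.
by rewrite (_ : `|(x.1 + 1 + s + 1)%R|%N = (0 + t)%N) //; lia.
Qed.

Lemma op_space xs : all homog xs -> sL'_h (total_degree xs + 1) (op xs).
Proof.
move=> Sxs; split.
  case: xs Sxs => [|x [|y [|z xs]]] Sxs; try exact: L'_space0.
  move: Sxs => /and3P[hx hy _]; rewrite /total_degree !big_cons big_nil /=.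
  rewrite -[_ *: _]addr0; apply: L'_space_lin; last exact: L'_space0.
  have hQ := homog_L' charK0 hx; have hQ' := homog_L' charK0 hy.
  apply/(L'_spaceP charK0).
  rewrite addr0 (_ : x.1 + y.1 + 1 + 1 = (x.1 + 1) + (y.1 + 1)); last by lia.
  split=> [|n0]; first exact: (bihomog_br _ _ hQ hQ').
  have [x0|x0] := ltP (x.1 + 1) 0.
    by rewrite (homog_L'0 charK0 hx x0) br0l //; apply: bihomog_ml hQ'.
  by rewrite (homog_L'0 charK0 hy) ?br0r //; [apply: bihomog_ml hQ | lia].
apply: unsh_closed => [|a f h|L R s].
- exact: h_space0.
- exact: h_space_lin.
case: L s => [|x [|? ?]] s; try exact: h_space0.
have [/= /andP[hx _] SR] := splitting_homog s Sxs.
have -> : total_degree xs = x.1 + total_degree R.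
  by rewrite /total_degree (splitting_sum _ s) big_cons big_nil addr0.
exact: op_h1_space.
Qed.

Lemma op_h1_linl x y z a R : par x = par z -> par y = par z -> all homog R ->
  z.2 = a *: x.2 + y.2 -> op_h1 z R = a *: op_h1 x R + op_h1 y R.
Proof.
move=> xz yz SR E; rewrite /op_h1 xz yz E /=.
by rewrite iter_br_lin // proj_h_lin.
Qed.

Lemma op_h1_linr w x y z a us vs : par x = par z -> par y = par z -> homog w ->
  all homog us -> all homog vs -> z.2 = a *: x.2 + y.2 ->
  op_h1 w (us ++ z :: vs) = a *: op_h1 w (us ++ x :: vs) + op_h1 w (us ++ y :: vs).
Proof.
move=> xz yz hw Sus Svs E; rewrite /op_h1 !iter_br_cat /= xz yz E /=.
rewrite br_linr ?iter_br_lin ?proj_h_lin //.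
exact: (bihomog_ml (iter_br_bihomog charK0 _ (homog_L' charK0 hw) Sus)).
Qed.

Lemma homog_ml x : homog x -> multilinear x.2.1 /\ multilinear x.2.2.
Proof.
by move=> hx; split; [apply: bihomog_ml (homog_L' charK0 hx) | apply: bihomog_ml (homog_h
  charK0 hx)].
Qed.

Lemma op_L'_mlin us vs x y z a : par x = par z -> par y = par z ->
  all homog us -> all homog vs -> z.2 = a *: x.2 + y.2 ->
  op_L' (us ++ z :: vs) = a *: op_L' (us ++ x :: vs) + op_L' (us ++ y :: vs).
Proof.
move=> xz yz Sus Svs E; case: us Sus => [|u [|u' us]].
- case: vs Svs => [|v [|v' vs]]; rewrite /= ?scaler0 ?addr0 //.
  rewrite andbT => /homog_ml[vl _]; rewrite xz yz E /= br_linl //.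
  by rewrite scalerDr !scalerA mulrC.
- rewrite /= andbT => /homog_ml[ul _]; case: vs Svs => [|v vs];
  rewrite /= ?scaler0 ?addr0 //.
  by rewrite xz yz E /= br_linr // scalerDr !scalerA mulrC.
by case: us => [|u'' us] /=; rewrite scaler0 addr0.
Qed.

Lemma op_mlin us vs x y z a : par x = par z -> par y = par z ->
  all homog us -> all homog vs -> z.2 = a *: x.2 + y.2 ->
  op (us ++ z :: vs) = a *: op (us ++ x :: vs) + op (us ++ y :: vs).
Proof.
move=> xz yz Sus Svs E; congr pair; first exact: op_L'_mlin.
apply: (@unsh_mlin _ _ _ _ homog) => // us' vs' R S1 S2 S3.
  case: us' S1 => [|u us'] S1; last by case: us' S1 => [|? ?] /=; rewrite scaler0 addr0.
  by case: vs' S2 => [|? ?] S2 /=; rewrite ?scaler0 ?addr0 //; apply: op_h1_linl.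
case: R S3 => [|w [|? ?]] S3; rewrite ?scaler0 ?addr0 //.
by apply: op_h1_linr => //; move: S3 => /andP[].
Qed.

(** The sign in [op_L'] is the one by which the shift turns a graded antisymmetric bracket into a
    graded symmetric operation. *)
Lemma op_L'_sym : graded_sym par homog (@op_L' K g V).
Proof.
case=> [|u [|? [|? ?]]] x y [|v vs] S; rewrite /= ?scaler0 //.
rewrite (br_sym (~~ par x)) !scalerA -[- sgn _]mulN1r -(expr1 (-1)) -[_ ^+ 1]/(sgn true).
rewrite -!signr_addb; congr (sgn _ *: _).
by case: (par x); case: (par y).
Qed.

Lemma op_h1_sym x : homog x -> graded_sym par homog (op_h1 x).
Proof.
move=> hx us y z vs S; rewrite /op_h1.
have := iter_br_sym charK0 (homog_L' charK0 hx) S.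
rewrite odd_absz_succ => ->; rewrite -[_ *: iter_br _ _ _]addr0 proj_h_lin.
by rewrite proj_h0 addr0.
Qed.

Lemma op_sym : graded_sym par homog (@op K g V).
Proof.
move=> us x y vs S; congr pair; first exact: op_L'_sym.
apply: (@unsh_swap _ _ _ _ homog) => // us' vs' R S1 S2.
  case: us' S1 => [|u [|? ?]] S1; rewrite ?scaler0 //.
case: R S2 => [|w [|? ?]] S2; rewrite ?scaler0 //.
by apply: op_h1_sym => //; move: S2 => /andP[].
Qed.

End OperationSymmetry.

(** * Generalized Jacobi identities of the untwisted algebra *)

Section Jacobi.
Variables (K : fieldType) (charK0 : [pchar K] =i pred0) (g V : lmodType K).
Local Notation C := (cochain g V).
Local Notation X := (int * (C * C))%type.
Local Notation sgn b := (sgn K b).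
Local Notation par := (@odd_degree K (C * C)%type).
Local Notation parity := (parity_by par).
Local Notation unsh := (unsh (K := K) par).
Local Notation homog := (homog_in (@sL'_h K g V)).
Local Notation op := (@op K g V).
Implicit Types (f h P Q N : C) (xs us vs L R A B : seq X) (x y z : X).

Lemma par_graded_value xs : par (graded_value op xs) = ~~ parity xs.
Proof. by rewrite /odd_degree odd_absz_succ parity_total_degree. Qed.

Lemma homog_graded_value xs : all homog xs -> homog (graded_value op xs).
Proof. by move=> Sxs; apply/homog_inP; apply: op_space. Qed.

Lemma homog_parity_L' x : homog x -> homog_parity (~~ par x) x.2.1.
Proof.
by move=> /(homog_L' charK0)/bihomog_parity; rewrite odd_absz_succ.
Qed.

Lemma homog_altern_L' x : homog x -> altern x.2.1.
Proof. by move/(homog_L' charK0)/bihomog_altern. Qed.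

(** Only sequences of three arguments matter; their splittings with two entries on the left give the
    terms of [br_Jacobi], up to shift signs. *)
Lemma op_L'_Jacobi xs : all homog xs ->
  unsh xs (fun L R => op_L' (graded_value op L :: R)) = 0.
Proof.
move=> Sxs; have [|sz] := eqVneq (size xs) 3; last first.
  apply: unsh0P => L [|y [|? ?]] s //; have := splitting_size s; move: s.
  case: L => [|x1 [|x2 [|? ?]]] s sL; rewrite /=; try (by rewrite sL eqxx in sz);
  by have [_ /= /andP[/(homog_ml charK0)[yl _] _]] := splitting_homog s Sxs;
    rewrite br0l ?scaler0.
case: xs Sxs => [|x [|y [|z [|? ?]]]] //= /and4P[hx hy hz _] _.
have [[xl _] [yl _] [zl _]] := And3 (homog_ml charK0 hx) (homog_ml charK0 hy) (homog_ml
  charK0 hz).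
rewrite !par_graded_value /= !scaler0 !addr0 !add0r !addbF !andbF !scale1r.
have ax := homog_altern_L' hx; have ay := homog_altern_L' hy; have az := homog_altern_L' hz.
have J := br_Jacobi ax ay az (homog_parity_L' hx) (homog_parity_L' hy) (homog_parity_L' hz).
have brZ p q a P Q : multilinear Q -> br p q (a *: P) Q = a *: br p q P Q.
  by move=> Ql; rewrite -[a *: P]addr0 br_linl // br0l // addr0.
have pE b c : ~~ ~~ (b (+) c) = ~~ b (+) ~~ c by case: b; case: c.
rewrite !brZ // !pE {}J [br (_ (+) _) _ _ x.2.1]br_sym.
move: (br _ _ x.2.1 _) (br _ _ _ y.2.1) => t1 t2.
by case: (par x); case: (par y); case: (par z);
  rewrite /= ?expr0 ?expr1 ?scaleNr ?scale1r ?opprK ?scaleNr ?scale1r ?scalerN ?opprD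
    ?opprK;
  zmod_cancel.
Qed.

(* Up to sign, P[P[x, A], [y, B]], the common form of the terms of the Jacobi
   identity: those with l_2 (x, y) inside give it through the derivation property
   of the brackets with h and proj_h_br, the others by moving P[x, A] past B. *)
Definition nested_op x A y B : C :=
  proj_h (br (~~ par x (+) parity A) (~~ par y (+) parity B)
            (op_h1 x A) (iter_br (~~ par y) y.2.1 B)).

Definition nested_op_term L R A B : C :=
  match L, R with
  | [:: x], [:: y] => sgn (~~ par x (+) (~~ par y && parity A)) *: nested_op x A y B
  | _, _ => 0
  end.

Lemma proj_hZ a f : proj_h (a *: f) = a *: proj_h f.
Proof. by rewrite -[a *: f]addr0 proj_h_lin proj_h0 addr0. Qed.

Lemma odd_degree_L' x : odd `|x.1 + 1| = ~~ par x.
Proof. exact: odd_absz_succ. Qed.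

(** The Leibniz rule distributes [R] over [x] and [y], then [proj_h_br] projects one of the two
    factors. Antisymmetry and cocommutativity bring the terms with [y] projected to the form of
    [nested_op] with the roles exchanged. *)
Lemma proj_h_br_L' x y R : homog x -> homog y -> all homog R ->
  proj_h (iter_br (~~ par x (+) ~~ par y)
    (sgn (~~ par x) *: br (~~ par x) (~~ par y) x.2.1 y.2.1) R) =
  unsh R (nested_op_term [:: x] [:: y]) +
  sgn (par x && par y) *: unsh R (nested_op_term [:: y] [:: x]).
Proof.
move=> hx hy SR; have hX := homog_L' charK0 hx; have hY := homog_L' charK0 hy.
have := iter_br_derivation charK0 hX hY SR; rewrite !odd_degree_L' /= iter_brZ // => ->.
rewrite proj_hZ (@unsh_lin _ _ _ _ _ (@proj_h K g V)); last exact: proj_h_lin.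
rewrite [in RHS](unsh_cocomm _ R (nested_op_term [:: y] _)) -!unshZ -unshD.
apply: eq_unsh => A B s; have [SA SB] := splitting_homog s SR.
rewrite /= proj_hZ (proj_h_br charK0 _ _ (iter_br_bihomog charK0 _ hX SA)
  (iter_br_bihomog charK0 _ hY SB)).
rewrite [X in _ + proj_h X]br_sym proj_hZ -/(op_h1 x A) -/(op_h1 y B).
rewrite -/(nested_op x A y B) -/(nested_op y B x A) !scalerDr !scalerA -!signr_addb;
  congr (_ + _ *: _).
rewrite -signrN -!signr_addb; congr (sgn _).
by case: (par x); case: (par y); case: (parity A); case: (parity B).
Qed.

(** As [op_h1 x A] lies in h, graded symmetry moves it past [B]; at the end it forms the outermost
    bracket, as in [nested_op]. *)
Lemma proj_h_iter_br_h x A y B : homog x -> homog y -> all homog A -> all homog B ->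
  let p := ~~ (par x (+) parity A) in
  proj_h (iter_br (~~ par y (+) p) (br (~~ par y) p y.2.1 (op_h1 x A)) B) =
  sgn (~~ (p && ~~ par y)) *: nested_op x A y B.
Proof.
move=> hx hy SA SB p.
(* Given a zero L' component, [op_h1 x A] becomes a homogeneous argument to which [iter_br_sym]
   applies. *)
pose t : X := (x.1 + total_degree A + 1, (0, op_h1 x A)).
have pt : par t = p.
  by rewrite /p /t /odd_degree odd_absz_succ odd_absz_add -parity_total_degree.
have ht : homog t.
  by apply/homog_inP; split; [apply: L'_space0 | apply: op_h1_space].
have hY := homog_L' charK0 hy.
have symY := iter_br_sym charK0 hY; rewrite odd_degree_L' in symY.
have /= M := @graded_sym_move _ _ _ _ homog _ [::] t B [::] symY.
have E : iter_br (~~ par y) y.2.1 (t :: B) =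
    sgn (p && parity B) *: iter_br (~~ par y) y.2.1 (B ++ [:: t]).
  by rewrite M ?all_cat /= ?SB ?ht // cats0 pt scalerA -signr_addb addbb scale1r.
have -> : iter_br (~~ par y (+) p) (br (~~ par y) p y.2.1 (op_h1 x A)) B =
    sgn (p && parity B) *: iter_br (~~ par y) y.2.1 (B ++ [:: t]) by rewrite -E /= pt.
rewrite iter_br_cat /= pt br_sym scalerA proj_hZ /nested_op -/p.
have -> : ~~ par x (+) parity A = p by rewrite /p addNb.
rewrite -signrN -!signr_addb; congr (sgn _ *: _).
by clear M E pt; case: p; case: (par y); case: (parity B).
Qed.

(** When [z] is the value of an inner operation, the first term uses its L' component and the second
    its h component: the two halves of the Jacobi sum. *)
Lemma op_h_cons z R : op_h (z :: R) = op_h1 z R +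
  unsh R (fun L S => if L is [:: y] then sgn (par z && par y) *: op_h1 y (z :: S) else 0).
Proof.
rewrite /op_h /=; congr (_ + _); first exact: unsh_nil.
by apply: eq_unsh => -[|y [|? ?]] S _; rewrite ?scaler0 //= addbF.
Qed.

Lemma op_h1_op xs : all homog xs ->
  unsh xs (fun L R => op_h1 (graded_value op L) R) =
  unsh xs (fun L R => unsh L (fun A B => unsh R (nested_op_term A B))).
Proof.
move=> Sxs; apply: eq_unsh => L R s; have [SL SR] := splitting_homog s Sxs.
rewrite /op_h1 par_graded_value negbK.
have [sz|sz] := eqVneq (size L) 2; last first.
  have -> : (graded_value op L).2.1 = 0 by case: L {SL s} sz => [|x [|y [|? ?]]].
  rewrite iter_br0 // proj_h0; symmetry; apply: unsh0P => A B /splitting_size sL;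
    apply: unsh0P => A' B' _.
  by case: A B sL => [|x [|? ?]] [|y [|? ?]] sL //; rewrite sL in sz.
case: L SL sz {s} => [|x [|y [|? ?]]] //= /and3P[hx hy _] _.
have -> : par x (+) (par y (+) false) = ~~ par x (+) ~~ par y.
  by rewrite addbF addNb addbN negbK.
have T1 : unsh R (nested_op_term [:: x; y] [::]) = 0 by apply: unsh0.
have T2 : unsh R (nested_op_term [::] [:: x; y]) = 0 by apply: unsh0.
rewrite proj_h_br_L' // T1 ?T2 !addbF ?andbF ?scale1r ?scaler0 ?addr0 ?add0r.
by [].
Qed.

(** Here [x] is grouped with its own arguments, and [y] with its own, whereas [op_h1_op] groups [x]
    with [y]. [unsh_interchange] converts one grouping into the other; the minus sign makes the two
    halves cancel. *)
Lemma op_h1_op_h xs : all homog xs ->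
  unsh xs (fun L R => unsh R (fun A B => if A is [:: y] then
    sgn (par (graded_value op L) && par y) *: op_h1 y (graded_value op L :: B) else 0)) =
  - unsh xs (fun L R => unsh L (fun A B => unsh R (nested_op_term A B))).
Proof.
move=> Sxs.
pose H A B D E : C := - sgn (parity B && parity D) *: nested_op_term A D B E.
transitivity (unsh xs (fun L R => unsh L (fun A B => unsh R (fun D E => H A B D E)))).
  apply: eq_unsh => L R s; have [SL SR] := splitting_homog s Sxs.
  rewrite -unsh_exchange; apply: eq_unsh => D E sDE; have [SD SE] := splitting_homog sDE SR.
  rewrite par_graded_value.
  have H0 A B : H A B [::] E = 0 by rewrite /H /nested_op_term; case: A => [|? [|? ?]];
    rewrite scaler0.
  case: D SD {sDE} => [|y [|y' D]] SD.
  - by rewrite unsh0P.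
  - have hy : homog y by case/andP: SD.
    have yl := (homog_ml charK0 hy).1.
    rewrite /op_h1 /= par_graded_value.
    pose h f := sgn (~~ parity L && par y) *:
      proj_h (iter_br (~~ par y (+) ~~ parity L) (br (~~ par y) (~~ parity L) y.2.1 f) E).
    have hl a f f' : h (a *: f + f') = a *: h f + h f'.
      by rewrite /h br_linr // iter_br_lin // proj_h_lin scalerDr !scalerA mulrC.
    rewrite -/(h (op_h L)) /op_h (@unsh_lin _ _ _ _ _ h) //.
    apply: eq_unsh => A B sAB; have [SA SB] := splitting_homog sAB SL.
    have h0 : h 0 = 0 by rewrite /h br0r // iter_br0 // proj_h0 scaler0.
    rewrite /H; case: A SA sAB => [|x [|? ?]] SA sAB /=; rewrite ?scaler0 //.
    have hx : homog x by case/andP: SA.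
    have := proj_h_iter_br_h hx hy SB SE.
    rewrite /h (splitting_parity _ sAB) /= addbF => ->.
    rewrite -signrN !scalerA -!signr_addb; congr (sgn _ *: _).
    by case: (par x); case: (par y); case: (parity B).
  by rewrite unsh0P // => A B _; rewrite /H; case: A => [|? [|? ?]]; rewrite scaler0.
rewrite unsh_interchange -unshN; apply: eq_unsh => L R _.
rewrite -unshN; apply: eq_unsh => A B _; rewrite -unshN; apply: eq_unsh => D E _.
by rewrite /H scaleNr scalerN scalerA -signr_addb addbb scale1r.
Qed.

Lemma op_h_Jacobi xs : all homog xs ->
  unsh xs (fun L R => op_h (graded_value op L :: R)) = 0.
Proof.
move=> Sxs; under eq_unsh do rewrite op_h_cons.
by rewrite unshD op_h1_op // op_h1_op_h // subrr.
Qed.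

Lemma op_Jacobi xs : all homog xs ->
  unsh xs (fun L R => op (graded_value op L :: R)) = 0.
Proof.
move=> Sxs; rewrite [LHS]surjective_pairing; congr pair.
  rewrite -[RHS](op_L'_Jacobi Sxs).
  by rewrite (@unsh_lin _ _ _ _ _ (fun u : C * C => u.1)).
rewrite -[RHS](op_h_Jacobi Sxs).
by rewrite (@unsh_lin _ _ _ _ _ (fun u : C * C => u.2)).
Qed.

End Jacobi.

(** * Twisting *)

Lemma triangular_sum (M : nmodType) n (u : nat -> nat -> M) :
  \sum_(k < n) \sum_(i < k.+1) u i (k - i)%N = \sum_(i < n) \sum_(j < n - i) u i j.
Proof.
elim: n => [|n IH]; first by rewrite !big_ord0.
rewrite big_ord_recr /= IH [RHS]big_ord_recr /= subSn // subnn big_ord1.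
rewrite [X in _ + X]big_ord_recr /= subnn addrA; congr (_ + _).
rewrite -big_split /=; apply: eq_bigr => i _.
by rewrite subSn ?big_ord_recr //= ltnW.
Qed.

Lemma big_ord_trim (M : nmodType) m n (F : nat -> M) : (m <= n)%N ->
  (forall i, (m <= i)%N -> F i = 0) -> \sum_(i < n) F i = \sum_(i < m) F i.
Proof.
move=> /subnKC <- F0; rewrite big_split_ord /= [X in _ + X]big1 ?addr0 // => i _.
by rewrite F0 // leq_addr.
Qed.

(** The antidiagonals of index below 2m exhaust the square of side [m]; this is the Cauchy product
    of two truncated exponential series. *)
Lemma square_sum (M : nmodType) m (u : nat -> nat -> M) :
  (forall i j, (m <= i)%N || (m <= j)%N -> u i j = 0) ->
  \sum_(k < m + m) \sum_(i < k.+1) u i (k - i)%N = \sum_(i < m) \sum_(j < m) u i j.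
Proof.
move=> u0; rewrite triangular_sum.
rewrite (@big_ord_trim _ m _ (fun i => \sum_(j < m + m - i) u i j)) ?leq_addr //;
  last first.
  by move=> i im; rewrite big1 // => j _; rewrite u0 // im.
apply: eq_bigr => i _; apply: big_ord_trim => [|j jm]; last by rewrite u0 // jm orbT.
by have := ltn_ord i; lia.
Qed.

Lemma fsbig_trim (M : zmodType) m (P : set nat) (F : nat -> M) :
  (forall i, P i -> (m <= i)%N -> F i = 0) -> (forall i, (i < m)%N -> ~ P i -> F i = 0) ->
  \sum_(i \in P) F i = \sum_(i < m) F i.
Proof.
move=> F0 F0'; rewrite fsbig_ord.
rewrite (fsbig_widen P (P `|` `I_m)); last 2 first.
- by move=> i Pi; left.
- by move=> i [[//|im] nP]; apply: F0'.
apply/esym/fsbig_widen; first by move=> i im; right.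
by move=> i [[Pi|//] /negP]; rewrite -leqNgt; apply: F0.
Qed.

Section Linfty.
Variables (K : fieldType) (charK0 : [pchar K] =i pred0) (M : lmodType K).
Local Notation X := (int * M)%type.
Local Notation sgn b := (sgn K b).
Local Notation par := (@odd_degree K M).
Local Notation unsh := (unsh (K := K) par).
Implicit Types (E : int -> set M) (l : seq X -> M) (xs us vs L R : seq X) (x y z : X).

(* L-infinity algebras with an operation l_0 = 0, which lets the Jacobi identity
   be a sum over all splittings; for a twisted algebra, l_0 = 0 is the
   Maurer-Cartan equation. *)
Definition Linfty_ops E l :=
  [/\ l [::] = 0, is_graded_space E,
      forall xs, all (homog_in E) xs -> E (total_degree xs + 1) (l xs),
      op_multilinear E l & graded_sym par (homog_in E) l] /\
  forall xs, all (homog_in E) xs -> unsh xs (fun L R => l (graded_value l L :: R)) = 0.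

Lemma graded_space0 E d : is_graded_space E -> E d 0.
Proof. by case/(_ d). Qed.

Lemma graded_space_lin E d a u v : is_graded_space E -> E d u -> E d v -> E d (a *: u + v).
Proof. by move=> H Eu Ev; case: (H d) => _; apply. Qed.

Lemma op_multilinear0 E l us d vs : is_graded_space E -> op_multilinear E l ->
  all (homog_in E) us -> all (homog_in E) vs -> l (us ++ (d, 0) :: vs) = 0.
Proof.
move=> Eg lm /homogeneous_all Hus /homogeneous_all Hvs.
have E0 := graded_space0 d Eg.
have := lm us vs d 1 0 0 Hus Hvs E0 E0; rewrite !scale1r addr0.
by move=> /(congr1 (fun w => w - l (us ++ (d, 0) :: vs))); rewrite subrr addrK.
Qed.

Lemma op_multilinear_sum E l us d vs (I : Type) (r : seq I) (c : I -> K) (u : I -> M) :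
  is_graded_space E -> op_multilinear E l ->
  all (homog_in E) us -> all (homog_in E) vs -> (forall i, E d (u i)) ->
  E d (\sum_(i <- r) c i *: u i) /\
  l (us ++ (d, \sum_(i <- r) c i *: u i) :: vs) =
  \sum_(i <- r) c i *: l (us ++ (d, u i) :: vs).
Proof.
move=> Eg lm Hus Hvs Eu; elim: r => [|i r [IHE IH]].
  by rewrite !big_nil (op_multilinear0 _ Eg lm) //; split=> //; apply: graded_space0.
rewrite !big_cons; split; first exact: graded_space_lin.
by rewrite lm ?IH //; apply/homogeneous_all.
Qed.

Lemma Koszul_signE xs (s : 'S_(size xs)) :
  Koszul_sign s = koszul K (par \o tnth (in_tuple xs)) s.
Proof.
apply: eq_bigr => i _; apply: eq_bigr => j _.
by rewrite exprN1z abszM oddM.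
Qed.

Lemma Linfty_ops_algebra E l : Linfty_ops E l -> is_Linfty_algebra E l.
Proof.
move=> [[l0 Eg ld lm ls] lJ]; split=> //.
- by move=> xs _ /homogeneous_all; apply: ld.
- move=> xs s _ /homogeneous_all Sxs; rewrite Koszul_signE.
  have := @graded_sym_perm K X par M (homog_in E) _ l (tnth (in_tuple xs)) s ls.
  rewrite map_tnth_enum; apply=> i.
  by apply: (allP Sxs); apply: (mem_tnth i (in_tuple xs)).
move=> xs _ /homogeneous_all Sxs; rewrite -[RHS](lJ xs Sxs) big_add1 /= big_mkord.
have E1 (i : 'I_(size xs)) : \sum_(s : 'S_(size xs) | is_shuffle i.+1 s) Koszul_sign s *:
       l (graded_value l (take i.+1 (reorder s)) :: drop i.+1 (reorder s)) =
    unsh xs (fun L R => if size L == i.+1 then l (graded_value l L :: R) else 0).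
  have := (@sum_shuffle K X par M (size xs) i.+1 (tnth (in_tuple xs))
    (fun L R => l (graded_value l L :: R)) (ltn_ord i)).
  by rewrite map_tnth_enum => /= <-; apply: eq_bigr => s _; rewrite Koszul_signE.
rewrite (eq_bigr _ (fun i _ => E1 i)) -unsh_sum; apply: eq_unsh => L R s.
move: (Sxs); rewrite (splitting_all _ s) => /andP[SL SR].
case: L SL s => [|x L] SL s.
  (* The empty left part is absent from the definition, where i starts at 1; it contributes nothing
     because l_0 = 0. *)
  rewrite big1 // /graded_value l0 /total_degree big_nil.
  by rewrite (op_multilinear0 (us := [::]) _ Eg lm).
have szL : (size L < size xs)%N by rewrite (splitting_size s) /= addSn ltnS leq_addr.
rewrite (bigD1 (Ordinal szL)) //= eqxx big1 ?addr0 // => i.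
by rewrite -val_eqE /= eqSS eq_sym => /negPf ->.
Qed.

End Linfty.

Lemma fact_bin_inv (K : fieldType) (charK0 : [pchar K] =i pred0) n i : (i <= n)%N ->
  (n`!%:R : K)^-1 * 'C(n, i)%:R = (i`!%:R)^-1 * ((n - i)`!%:R)^-1.
Proof.
move=> lein; have f0 m : m`!%:R != 0 :> K.
  by move/pcharf0P: charK0 => ->; rewrite -lt0n fact_gt0.
rewrite -(bin_fact lein) !natrM; field.
move/pcharf0P: charK0 => P; rewrite !f0 /= P -lt0n bin_gt0 lein.
by [].
Qed.

Section Twist.
Variables (K : fieldType) (charK0 : [pchar K] =i pred0) (M : lmodType K).
Local Notation X := (int * M)%type.
Local Notation par := (@odd_degree K M).
Local Notation parity := (parity_by par).
Local Notation unsh := (unsh (K := K) par).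
Variables (E : int -> set M) (l : seq X -> M) (c : nat).
Local Notation homog_in := (homog_in E).
Implicit Types (xs us vs L R : seq X) (x y z : X).

(** By the hypothesis [lnil], [l] vanishes once the length reaches [c] plus this norm. Entries of
    degree 0 raise the length but not the norm, which makes the twisted sums finite. *)
Definition degree_norm xs : nat := (\sum_(x <- xs) `|x.1|)%N.

Hypothesis Ll : Linfty_ops E l.
Hypothesis lnil : forall xs, all homog_in xs -> (c + degree_norm xs <= size xs)%N -> l xs
  = 0.

Let Eg : is_graded_space E. Proof. by case: Ll => -[? ? ? ? ?] _. Qed.
Let lm : op_multilinear E l. Proof. by case: Ll => -[? ? ? ? ?] _. Qed.
Let ls : graded_sym par homog_in l. Proof. by case: Ll => -[? ? ? ? ?] _. Qed.
Let l0 : l [::] = 0. Proof. by case: Ll => -[? ? ? ? ?] _. Qed.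
Let ld xs : all homog_in xs -> E (total_degree xs + 1) (l xs). Proof. by case: Ll => -[?
  ? H ? ?] _; apply: H. Qed.

Section Even.
Variables (b : M) (Eb : E 0 b).

Lemma hom_nseq n : all homog_in (nseq n (0, b)).
Proof. by rewrite all_nseq; apply/orP; right; apply/homog_inP. Qed.

Lemma parity_nseq0 n : parity (nseq n (0, b)) = false.
Proof. by elim: n. Qed.

Lemma total_degree_nseq0 n xs : total_degree (nseq n (0, b) ++ xs) = total_degree xs.
Proof.
rewrite /total_degree big_cat /= big1_seq ?add0r // => x.
by rewrite mem_nseq /= => /andP[_ /eqP ->].
Qed.

Lemma degree_norm_nseq0 n xs : degree_norm (nseq n (0, b) ++ xs) = degree_norm xs.
Proof.
rewrite /degree_norm big_cat /= big1_seq ?add0n // => x.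
by rewrite mem_nseq /= => /andP[_ /eqP ->].
Qed.

Lemma op_nseq_eq0 n xs : all homog_in xs -> (c + degree_norm xs <= n)%N ->
  l (nseq n (0, b) ++ xs) = 0.
Proof.
move=> Sxs le_n; apply: lnil; first by rewrite all_cat hom_nseq.
by rewrite degree_norm_nseq0 size_cat size_nseq (leq_trans le_n) ?leq_addr.
Qed.

Lemma twistE xs m : all homog_in xs -> (c + degree_norm xs <= m)%N ->
  twist l b xs = \sum_(n < m) (n`!%:R : K)^-1 *: l (nseq n (0, b) ++ xs).
Proof.
move=> Sxs le_m; apply: fsbig_trim => [n _ le_n|n _ []//].
by rewrite op_nseq_eq0 ?scaler0 // (leq_trans le_m).
Qed.

Lemma op_nseq_move n us x vs : all homog_in us -> homog_in x -> all homog_in vs ->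
  l (us ++ nseq n (0, b) ++ x :: vs) = l (us ++ x :: nseq n (0, b) ++ vs).
Proof.
move=> Sus Sx Svs; rewrite (graded_sym_move ls); last first.
  by rewrite !all_cat /= Sus Sx Svs hom_nseq.
by rewrite parity_nseq0 andbF scale1r.
Qed.

End Even.

(** The binomial theorem for equal even arguments; the prefix [us] accumulates the arguments already
    expanded. *)
Lemma op_nseqD b b' n us : E 0 b -> E 0 b' -> all homog_in us ->
  l (us ++ nseq n (0, b + b')) =
  \sum_(i < n.+1) l (us ++ nseq i (0, b) ++ nseq (n - i) (0, b')) *+ 'C(n, i).
Proof.
move=> Eb Eb'; have Ebb : E 0 (b + b').
  by rewrite -[b]scale1r; apply: (graded_space_lin _ Eg).
elim: n us => [|n IH] us Sus; first by rewrite big_ord1 mulr1n.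
have hb : homog_in (0, b) by apply/homog_inP.
have hb' : homog_in (0, b') by apply/homog_inP.
have := @lm us (nseq n (0, b + b')) 0 1 b b'; rewrite !scale1r => -> //; last 2 first.
- exact/homogeneous_all.
- exact/homogeneous_all/hom_nseq.
rewrite -cat_rcons IH ?all_rcons ?hb // -[X in _ + l X]cat_rcons IH ?all_rcons ?hb' //.
rewrite -(Pascal_sum n (fun i => l (us ++ nseq i (0, b) ++ nseq (n.+1 - i) (0, b')))).
congr (_ + _); apply: eq_bigr => i _; congr (_ *+ _); rewrite cat_rcons //.
rewrite subSn -1?ltnS //= op_nseq_move //.
exact: hom_nseq.
Qed.

Section MaurerCartan.
Variables (a : M) (Ea : E 0 a) (MCa : twist l a [::] = 0).
Local Notation lt := (twist l a).

Let homa n xs : all homog_in xs -> all homog_in (nseq n (0, a) ++ xs).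
Proof. by move=> Sxs; rewrite all_cat hom_nseq. Qed.

Lemma splitting_degree_norm xs L R : splitting xs L R ->
  degree_norm xs = (degree_norm L + degree_norm R)%N.
Proof. exact: splitting_sum. Qed.

Lemma twist_degree xs : all homog_in xs -> E (total_degree xs + 1) (lt xs).
Proof.
move=> Sxs; rewrite (twistE Ea Sxs (leqnn _)).
elim/big_rec: _ => [|n u _ IH]; first exact: graded_space0.
apply: graded_space_lin => //.
by rewrite -(total_degree_nseq0 a n); apply: ld; apply: homa.
Qed.

Lemma twist_mlin : op_multilinear E lt.
Proof.
move=> us vs d k u v /homogeneous_all Sus /homogeneous_all Svs Eu Ev.
have H w : E d w -> all homog_in (us ++ (d, w) :: vs).
  by move=> Ew; rewrite all_cat /= Sus Svs andbT; apply/homog_inP.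
have N w : degree_norm (us ++ (d, w) :: vs) = degree_norm (us ++ (d, 0) :: vs).
  by rewrite /degree_norm !big_cat /= !big_cons.
rewrite !(@twistE a Ea _ (c + degree_norm (us ++ (d, 0) :: vs))) ?N //;
  try exact: H; last by apply: H; apply: graded_space_lin.
rewrite scaler_sumr -big_split /=; apply: eq_bigr => n _.
rewrite !catA lm //; last 2 first.
- by apply/homogeneous_all; apply: homa.
- exact/homogeneous_all.
by rewrite scalerDr !scalerA mulrC.
Qed.

Lemma twist_sym : graded_sym par homog_in lt.
Proof.
move=> us x y vs S; have S' : all homog_in (us ++ y :: x :: vs).
  by move: S; rewrite !all_cat /= => /and4P[-> -> -> ->].
have N : degree_norm (us ++ x :: y :: vs) = degree_norm (us ++ y :: x :: vs).
  by rewrite /degree_norm !big_cat /= !big_cons; lia.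
rewrite (twistE Ea S (leqnn _)) (@twistE a Ea _ (c + degree_norm (us ++ x :: y :: vs)))
  ?N //.
rewrite scaler_sumr; apply: eq_bigr => n _.
by rewrite catA ls -?catA ?homa // !scalerA mulrC.
Qed.

(* Since a is even, distributing the n copies of a in the Jacobi identity at
   nseq n a ++ xs produces binomial coefficients; dividing by n! and summing over
   n gives the twisted identity at xs. *)
Lemma twist_Jacobi xs : all homog_in xs ->
  unsh xs (fun L R => lt (graded_value lt L :: R)) = 0.
Proof.
(* The final 1 allows for the value of an inner operation, whose degree exceeds the total degree of
   its arguments by one. *)
move=> Sxs; pose m := (c + degree_norm xs + 1)%N.
pose t i j := unsh xs (fun L R =>
  l (graded_value l (nseq i (0, a) ++ L) :: nseq j (0, a) ++ R)).
have gvE i L : graded_value l (nseq i (0, a) ++ L) =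
    (total_degree L + 1, l (nseq i (0, a) ++ L)).
  by rewrite /graded_value total_degree_nseq0.
have Egv i L : all homog_in L -> E (total_degree L + 1) (l (nseq i (0, a) ++ L)).
  by move=> SL; rewrite -(total_degree_nseq0 a i); apply: ld; apply: homa.
have norm_gv L : (degree_norm L + 1 >= `|(total_degree L + 1)%R|)%N.
  rewrite /degree_norm /total_degree; elim: L => [|x L IH]; first by rewrite !big_nil.
  rewrite !big_cons; move: IH.
  by set u := \sum_(z <- L) z.1; set v := (\sum_(z <- L) `|z.1|)%N => IH; lia.
have tJ n : \sum_(i < n.+1) t i (n - i)%N *+ 'C(n, i) = 0.
  have := Ll.2 (nseq n (0, a) ++ xs) (homa n Sxs).
  by rewrite unsh_nseq.
have t0 i j : (m <= i)%N || (m <= j)%N -> t i j = 0.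
  move=> mij; apply: unsh0P => L R s; rewrite gvE.
  have /andP[SL SR] : all homog_in L && all homog_in R by rewrite -(splitting_all _ s).
  have nLR := splitting_degree_norm s.
  case/orP: mij => [mi|mj].
    rewrite op_nseq_eq0 //; last by move: mi; rewrite /m; lia.
    by apply: (op_multilinear0 (us := [::]) _ Eg lm) => //; apply: homa.
  have hgv : homog_in (total_degree L + 1, l (nseq i (0, a) ++ L)) by apply/homog_inP/Egv.
  rewrite -[LHS]/(l ([::] ++ _ :: _ ++ _)) -op_nseq_move //=.
  rewrite op_nseq_eq0 //= ?hgv //.
  rewrite /degree_norm big_cons -/(degree_norm R) /=.
  by have := norm_gv L; move: mj; rewrite /m; lia.
transitivity (\sum_(i < m) \sum_(j < m) ((i`!%:R : K)^-1 * (j`!%:R)^-1) *: t i j).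
  under [RHS]eq_bigr => i _ do under eq_bigr => j _ do rewrite -unshZ.
  under [RHS]eq_bigr => i _ do rewrite -unsh_sum.
  rewrite -unsh_sum; apply: eq_unsh => L R s.
  have /andP[SL SR] : all homog_in L && all homog_in R by rewrite -(splitting_all _ s).
  have nLR := splitting_degree_norm s.
  rewrite (@twistE a Ea _ m); last first.
  - rewrite /degree_norm big_cons -/(degree_norm R) /=.
    by have := norm_gv L; rewrite /m; lia.
  - by rewrite /= SR andbT; apply/homog_inP/twist_degree.
  rewrite /graded_value (@twistE a Ea L m) //; last by rewrite /m; lia.
  rewrite exchange_big /=; apply: eq_bigr => j _.
  have [_ ->] := @op_multilinear_sum _ _ E l (nseq j (0, a)) (total_degree L + 1) R
    'I_m (index_enum _) (fun i => (i`!%:R)^-1) (fun i : 'I_m => l (nseq i (0, a) ++ L))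
    Eg lm (hom_nseq Ea j) SR (fun i => Egv i L SL).
  rewrite scaler_sumr; apply: eq_bigr => i _.
  rewrite scalerA mulrC total_degree_nseq0; congr (_ *: _).
  rewrite -[LHS]/(l ([::] ++ _ ++ _)) op_nseq_move //.
  exact/homog_inP/Egv.
pose u i j := ((i`!%:R : K)^-1 * (j`!%:R)^-1) *: t i j.
rewrite -(@square_sum _ m u) => [|i j mij]; last by rewrite /u t0 ?scaler0.
rewrite big1 // => n _; rewrite -[RHS](scaler0 _ (n`!%:R)^-1) -[in RHS](tJ n) scaler_sumr.
apply: eq_bigr => i _; rewrite /u -fact_bin_inv //; last by rewrite -ltnS.
by rewrite -scaler_nat scalerA.
Qed.

Theorem twist_Linfty_ops : Linfty_ops E lt.
Proof.
split; last exact: twist_Jacobi.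
split=> //; [exact: twist_degree | exact: twist_mlin | exact: twist_sym].
Qed.

End MaurerCartan.

Lemma is_Maurer_CartanE (f : seq X -> M) b : f [::] = 0 -> E 0 b ->
  (forall k, (c <= k)%N -> f (nseq k (0, b)) = 0) ->
  is_Maurer_Cartan E f b <-> \sum_(k < c) (k`!%:R : K)^-1 *: f (nseq k (0, b)) = 0.
Proof.
move=> f0 Eb fc.
have S : \sum_(k \in [set k | (0 < k)%N]) (k`!%:R : K)^-1 *: f (nseq k (0, b)) =
    \sum_(k < c) (k`!%:R : K)^-1 *: f (nseq k (0, b)).
  apply: fsbig_trim => [k _ ck|k _ /negP]; first by rewrite fc ?scaler0.
  by rewrite -leqNgt leqn0 => /eqP ->; rewrite f0 scaler0.
rewrite /is_Maurer_Cartan S; split=> [[]//|fS]; split=> //.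
apply: (@sub_finite_set _ _ `I_c); last exact: finite_II.
move=> k [_ fk] /=; rewrite ltnNge; apply/negP => ck; apply: fk; exact: fc.
Qed.

Lemma Maurer_Cartan_twist a b : E 0 a -> E 0 b -> twist l a [::] = 0 ->
  is_Maurer_Cartan E (twist l a) b <-> twist l (a + b) [::] = 0.
Proof.
move=> Ea Eb MCa; have Eab : E 0 (a + b).
  by rewrite -[a]scale1r; apply: (graded_space_lin _ Eg).
have norm0 k : degree_norm (nseq k (0, b)) = 0%N.
  by rewrite -[nseq _ _]cats0 degree_norm_nseq0 // /degree_norm big_nil.
pose u i j := ((i`!%:R : K)^-1 * (j`!%:R)^-1) *: l (nseq i (0, a) ++ nseq j (0, b)).
have u0 i j : (c <= i)%N || (c <= j)%N -> u i j = 0.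
  move=> cij; rewrite /u lnil ?scaler0 //; first by rewrite all_cat !hom_nseq.
  rewrite degree_norm_nseq0 norm0 addn0 size_cat !size_nseq.
  by case/orP: cij => H; rewrite (leq_trans H) ?leq_addr ?leq_addl.
have ltE k : twist l a (nseq k (0, b)) = \sum_(i < c) (i`!%:R : K)^-1 *: l (nseq i (0, a)
  ++ nseq k (0, b)).
  by apply: twistE; rewrite ?hom_nseq ?norm0 ?addn0.
rewrite is_Maurer_CartanE //; last first.
  move=> k ck; rewrite ltE big1 // => i _; rewrite lnil ?scaler0 //;
    first by rewrite all_cat !hom_nseq.
  by rewrite degree_norm_nseq0 norm0 addn0 size_cat !size_nseq (leq_trans ck) ?leq_addl.
suff -> : twist l (a + b) [::] = \sum_(k < c) (k`!%:R : K)^-1 *: twist l a (nseq k (0,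
  b)) by [].
(* One double sum read in two ways: along antidiagonals it is the series at a + b, along columns the
   twisted series at b. *)
transitivity (\sum_(i < c) \sum_(j < c) u i j).
  rewrite -(square_sum u0) (@twistE _ Eab [::] (c + c)) //;
    last by rewrite /degree_norm big_nil leq_add2l.
  apply: eq_bigr => n _; rewrite cats0 (op_nseqD n (us := [::])) // scaler_sumr.
  apply: eq_bigr => i _; rewrite /u -fact_bin_inv //; last by rewrite -ltnS.
  by rewrite -scaler_nat scalerA.
rewrite exchange_big /=; apply: eq_bigr => k _; rewrite ltE scaler_sumr.
by apply: eq_bigr => i _; rewrite /u scalerA mulrC.
Qed.

End Twist.

(** * Arity bound and L-infinity identities for [l_op]; closed form of the lifts *)

Section LOp.
Variables (K : fieldType) (charK0 : [pchar K] =i pred0) (g V : lmodType K).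
Local Notation W := (g * V)%type.
Local Notation C := (cochain g V).
Local Notation X := (int * (C * C))%type.
Local Notation par := (@odd_degree K (C * C)%type).
Local Notation E := (@sL'_h K g V).
Local Notation homog := (homog_in (@sL'_h K g V)).
Implicit Types (xs us vs L R A B : seq X) (x y z : X).

(** Each bracket with h lowers the first index by one; from x.1 + 1 down to -1 this takes x.1 + 2
    brackets. *)
Lemma op_h1_eq0 x R : homog x -> all homog R -> (size R)%:Z <> x.1 + 1 + 1 -> op_h1 x R = 0.
Proof.
move=> hx SR sz; have hQ := homog_L' charK0 hx.
have hI := iter_br_bihomog charK0 (~~ par x) hQ SR.
rewrite /op_h1 (proj_h_bihomog charK0 hI); case: eqP => [e|//].
have [//|pos] := iter_br_neg charK0 (~~ par x) SR (bihomog_altern hQ).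
by exfalso; apply: sz; have := sum_absz_succ pos; lia.
Qed.

(** A nonzero [op_h1 x R] involves x.1 + 3 arguments in all, fewer than 4 plus the norm, and the
    operation on L' has only two; hence the constant 4. *)
Lemma op_nilpotent xs : all homog xs -> (4 + degree_norm xs <= size xs)%N -> op xs = 0.
Proof.
move=> Sxs sz; congr pair.
  by case: xs sz {Sxs} => [|x [|y [|z xs]]].
apply: unsh0P => -[|x [|? ?]] R s //; have [/= /andP[hx _] SR] := splitting_homog s Sxs.
apply: op_h1_eq0 => //; have := splitting_size s; have := splitting_degree_norm s.
rewrite [degree_norm [:: x]]/degree_norm big_cons big_nil /= addn0 => nE sE RE.
by move: sz RE; rewrite nE sE; move: (size R) (degree_norm R) x.1; clear; lia.
Qed.

Lemma l_op_Linfty_ops : Linfty_ops E (@l_op K g V).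
Proof.
have homs us vs (d : int) u v a : homogeneous E us -> homogeneous E vs ->
    E d u -> E d v ->
    [/\ all homog (us ++ (d, a *: u + v) :: vs), all homog (us ++ (d, u) :: vs) &
        all homog (us ++ (d, v) :: vs)].
  move=> /homogeneous_all Sus /homogeneous_all Svs Eu Ev.
  rewrite !all_cat /= Sus Svs !andbT; split; apply/homog_inP => //.
  exact: (graded_space_lin a (graded_sL'_h charK0 g V) Eu Ev).
split.
  split.
  - by rewrite l_opE // /op /op_h /=.
  - exact: graded_sL'_h.
  - by move=> xs Sxs; rewrite l_opE //; apply: op_space.
  - move=> us vs d a u v Hus Hvs Eu Ev.
    have [S1 S2 S3] := homs us vs d u v a Hus Hvs Eu Ev.
    by rewrite !l_opE //; apply: op_mlin => //; apply/homogeneous_all.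
  move=> us x y vs S; have {}S : all homog (us ++ x :: y :: vs) := S.
  rewrite !l_opE //; first exact: op_sym.
  by move: S; rewrite !all_cat /= => /and4P[-> -> -> ->].
move=> xs Sxs; rewrite -[RHS](op_Jacobi charK0 Sxs); apply: eq_unsh => L R s.
have [SL SR] := splitting_homog s Sxs.
rewrite /graded_value l_opE // l_opE //= SR andbT.
exact: (homog_graded_value charK0 SL).
Qed.

Lemma l_op_nilpotent xs : all homog xs -> (4 + degree_norm xs <= size xs)%N -> l_op xs = 0.
Proof. by move=> Sxs; rewrite l_opE //; apply: op_nilpotent. Qed.



(** The bracket of the semidirect product of g and V, when mu and rho satisfy the axioms. *)
Definition pair_op (mu : g -> g -> g) (rho : g -> V -> V) : C := fun ws =>
  if ws is [:: w1; w2] then (mu w1.1 w2.1, rho w1.1 w2.2 - rho w2.1 w1.2) else 0.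

Definition single_op (T : V -> g) : C := fun ws =>
  if ws is [:: w] then (T w.2, 0) else 0.

Lemma sum_shuffle_sign (N : lmodType K) (ws : seq W) k (F : seq W -> seq W -> N) :
  (k <= size ws)%N ->
  \sum_(s : 'S_(size ws) | is_shuffle k s)
     (-1 : K) ^+ s *: F (take k (reorder s)) (drop k (reorder s)) =
  unsh (fun=> true) ws (fun ys zs => if size ys == k then F ys zs else 0).
Proof.
move=> kn; have := @sum_shuffle K W (fun=> true) N (size ws) k (tnth (in_tuple ws)) F kn.
by rewrite map_tnth_enum /= => <-; under [RHS]eq_bigr do rewrite koszul_odd.
Qed.

Lemma lift_muE mu rho : lift_mu mu + lift_rho rho = pair_op mu rho :> C.
Proof.
apply/funext => ws; rewrite cochDE /lift_mu /lift_rho /lift_g /lift_V.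
case: ws => [|w1 [|w2 [|? ?]]]; rewrite /= ?addr0 //.
rewrite (@sum_shuffle_sign _ [:: w1;
  w2] 2 (fun ys zs => (mu (map fst ys)`_0 (map fst ys)`_1, 0))) //.
rewrite (@sum_shuffle_sign _ [:: w1;
  w2] 1 (fun ys zs => (0, rho (map fst ys)`_0 (map snd zs)`_0))) //=.
rewrite !scaler0 !addr0 !add0r /= expr0 expr1 scale1r scaleN1r.
by congr pair; rewrite /= ?addr0 ?add0r ?oppr0 ?addr0.
Qed.

Lemma lift_TE T : lift_T T = single_op T :> C.
Proof.
apply/funext => ws; rewrite /lift_T /lift_g.
case: ws => [|w [|? ?]]; rewrite //=.
rewrite (@sum_shuffle_sign _ [:: w] 0 (fun ys zs => (T (map snd zs)`_0, 0))) //=.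
by rewrite add0r expr0 scale1r.
Qed.

End LOp.

(** * Relative Rota-Baxter Lie algebras as Maurer-Cartan elements *)

Section LinearMaps.
Variable K : fieldType.

Lemma linear_props (U U' : lmodType K) (f : U -> U') : linear f ->
  [/\ f 0 = 0, {morph f : x y / x + y}, {morph f : x / - x} & forall a x, f (a *: x) = a
    *: f x].
Proof.
move=> fl; have f0 : f 0 = 0.
  by have := fl 1 0 0; rewrite !scale1r !addr0 => /(congr1 (fun w => w - f 0));
    rewrite subrr addrK.
have fZ a x : f (a *: x) = a *: f x by rewrite -[a *: x]addr0 fl f0 addr0.
split=> // [x y|x]; first by rewrite -[x in LHS]scale1r fl scale1r.
by rewrite -scaleN1r fZ scaleN1r.
Qed.

Lemma bilinear_props (U U' U'' : lmodType K) (f : U -> U' -> U'') : is_bilinear f ->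
  [/\ (forall x y z, f (x + y) z = f x z + f y z) * (forall x y z, f x (y + z) = f x y +
    f x z),
      (forall z, f 0 z = 0) * (forall x, f x 0 = 0),
      (forall x z, f (- x) z = - f x z) * (forall x z, f x (- z) = - f x z) &
      (forall a x z, f (a *: x) z = a *: f x z) * (forall a x z, f x (a *: z) = a *: f x
        z)].
Proof.
move=> [fl fr]; split; split.
- by move=> x y z; have [_ H _ _] := linear_props (fr z); exact: H.
- by move=> x y z; have [_ H _ _] := linear_props (fl x); exact: H.
- by move=> z; have [H _ _ _] := linear_props (fr z).
- by move=> x; have [H _ _ _] := linear_props (fl x).
- by move=> x z; have [_ _ H _] := linear_props (fr z); exact: H.
- by move=> x z; have [_ _ H _] := linear_props (fl x); exact: H.
- by move=> a x z; have [_ _ _ H] := linear_props (fr z); exact: H.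
by move=> a x z; have [_ _ _ H] := linear_props (fl x); exact: H.
Qed.

Lemma is_bilinear_add (U U' U'' : lmodType K) (f h : U -> U' -> U'') :
  is_bilinear f -> is_bilinear h -> is_bilinear (f + h).
Proof.
move=> [fl fr] [hl hr]; split=> [x a y z | z a x y].
  by rewrite !fctE fl hl scalerDr addrACA.
have Ef := fr z a x y; have Eh := hr z a x y.
by rewrite /= in Ef Eh; rewrite !fctE Ef Eh scalerDr addrACA.
Qed.

Lemma alt_bilinear_add (U : lmodType K) (f h : U -> U -> U) :
  alt_bilinear f -> alt_bilinear h -> alt_bilinear (f + h).
Proof.
move=> [fb f0] [hb h0]; split=> [|x]; first exact: is_bilinear_add.
by rewrite !fctE f0 h0 addr0.
Qed.

End LinearMaps.

Section PairOperation.
Variables (K : fieldType) (charK0 : [pchar K] =i pred0) (g V : lmodType K).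
Local Notation W := (g * V)%type.
Local Notation C := (cochain g V).
Implicit Types (mu : g -> g -> g) (rho : g -> V -> V) (T : V -> g).

Lemma alt_bilinear_anti mu x y : alt_bilinear mu -> mu x y = - mu y x.
Proof.
move=> [/bilinear_props[[Dl Dr] _ _ _] mxx]; apply/eqP; rewrite -addr_eq0; apply/eqP.
by have := mxx (x + y); rewrite Dl !Dr !mxx add0r addr0.
Qed.

Section PairOp.
Variables (mu : g -> g -> g) (rho : g -> V -> V).
Hypotheses (amu : alt_bilinear mu) (brho : is_bilinear rho).

Lemma pair_op_bihomog : bihomog 1 0 (pair_op mu rho).
Proof.
have [[mDl mDr] _ _ [mZl mZr]] := bilinear_props amu.1.
have [[rDl rDr] _ _ [rZl rZr]] := bilinear_props brho.
split; first split.
- move=> us vs a x y.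
  case: us => [|u [|? us]]; last by case: us => [|? ?] /=; rewrite scaler0 addr0.
    case: vs => [|v [|? ?]]; rewrite /= ?scaler0 ?addr0 //; congr pair.
      by rewrite /= mDl mZl.
    by rewrite /= rDl rDr rZl rZr scalerBr opprD addrACA.
  case: vs => [|v vs]; rewrite /= ?scaler0 ?addr0 //; congr pair.
    by rewrite /= mDr mZr.
  by rewrite /= rDl rDr rZl rZr scalerBr opprD addrACA.
- move=> [|u [|? [|? ?]]] x y [|? ?] _; rewrite /= ?scaler0 // expr1 scaleN1r.
  by congr pair; rewrite /= ?opprB // -alt_bilinear_anti.
- by case=> [|? [|? [|? ?]]] //.
case=> [|w1 [|w2 [|? ?]]]; rewrite /= ?phi0 ?scaler0 // expr0 scale1r /weight_scaling /=.
by congr pair; rewrite !rZr scalerBr.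
Qed.

End PairOp.

Lemma single_op_bihomog T : linear T -> bihomog 0 1 (single_op T).
Proof.
move=> Tl; have [_ _ _ TZ] := linear_props Tl; split; first split.
- move=> us vs a x y.
  case: us => [|? us]; last by case: us => [|? ?] /=; rewrite scaler0 addr0.
  by case: vs => [|? ?]; rewrite /= ?scaler0 ?addr0 //; congr pair;
    rewrite /= ?Tl ?scaler0 ?addr0.
- by move=> [|? [|? ?]] x y [|? ?] _; rewrite /= ?scaler0.
- by case=> [|? [|? ?]].
case=> [|w [|? ?]]; rewrite /= ?phi0 ?scaler0 // expr1 /weight_scaling /=.
by congr pair; rewrite /= ?TZ ?scaler0.
Qed.

Lemma circ_two (P Q : C) w1 w2 : circ P Q [:: w1; w2] =
  P [:: Q [:: w1; w2]] + P [:: Q [:: w1]; w2] - P [:: Q [:: w2]; w1] + P [:: Q [::]; w1;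
    w2].
Proof.
by rewrite /circ /= !expr0 !expr1 !scale1r !scaleN1r addrA.
Qed.

Lemma circ_pair_op mu rho w1 w2 w3 :
  let pi := pair_op mu rho in
  circ pi pi [:: w1; w2; w3] =
  pi [:: pi [:: w1; w2]; w3] - pi [:: pi [:: w1; w3]; w2] + pi [:: pi [:: w2; w3]; w1].
Proof.
by rewrite /circ /= !expr0 !expr1 !scaler0 !scale1r !scaleN1r !addr0 !add0r.
Qed.

(** The composite is the Jacobiator of the semidirect product bracket: three arguments in g isolate
    the Jacobi identity, two in g and one in V the representation axiom. *)
Lemma circ_pair_op_eq0 mu rho : alt_bilinear mu -> is_bilinear rho ->
  circ (pair_op mu rho) (pair_op mu rho) = 0 <->
  is_Lie_algebra mu /\ is_representation mu rho.
Proof.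
move=> amu brho; have hpi := pair_op_bihomog amu brho.
have [_ _ [mNl _] _] := bilinear_props amu.1.
have [[_ rDr] [r0l r0r] [_ rNr] _] := bilinear_props brho.
split=> [pi0|[[_ Jac] [_ rep]]].
  have ev w1 w2 w3 : circ (pair_op mu rho) (pair_op mu rho) [:: w1; w2; w3] = 0.
    by rewrite pi0.
  split; split=> //.
    move=> x y z; have /(congr1 fst) := ev (x, 0) (y, 0) (z, 0).
    rewrite circ_pair_op /= => H.
    rewrite (alt_bilinear_anti x (mu y z) amu) (alt_bilinear_anti y (mu z x) amu).
    rewrite (alt_bilinear_anti z (mu x y) amu) (alt_bilinear_anti z x amu) mNl.
    by rewrite -[RHS]oppr0 -[X in _ = - X]H; zmod_cancel.
  move=> x y v; have /(congr1 snd) := ev (x, 0) (y, 0) (0, v).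
  rewrite circ_pair_op /= !r0r !r0l !subr0 !sub0r !opprK => H.
  apply/eqP; rewrite -subr_eq0 -[X in _ == X]H; apply/eqP; zmod_cancel.
apply/funext => ws.
have [sz|sz] := eqVneq (size ws) 3; last first.
  by case: (bihomog_circ hpi hpi) => _ -> //; apply/eqP; lia.
case: ws sz => [|w1 [|w2 [|w3 [|? ?]]]] // _; rewrite circ_pair_op /=.
congr pair => /=.
  rewrite -[RHS]oppr0 -[X in _ = - X](Jac w1.1 w2.1 w3.1).
  rewrite (alt_bilinear_anti w1.1 (mu w2.1 _) amu) (alt_bilinear_anti w2.1 (mu w3.1 _) amu).
  rewrite (alt_bilinear_anti w3.1 (mu w1.1 _) amu) (alt_bilinear_anti w3.1 w1.1 amu).
  rewrite mNl.
  zmod_cancel.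
rewrite !rDr !rNr !rep; zmod_cancel.
Qed.

End PairOperation.

Section RotaBaxter.
Variables (K : fieldType) (charK0 : [pchar K] =i pred0) (g V : lmodType K).
Local Notation C := (cochain g V).
Local Notation X := (int * (C * C))%type.
Local Notation E := (@sL'_h K g V).
Local Notation homog := (homog_in (@sL'_h K g V)).
Implicit Types (mu : g -> g -> g) (rho : g -> V -> V) (T : V -> g).

Section Data.
Variables (mu : g -> g -> g) (rho : g -> V -> V) (T : V -> g).
Hypotheses (amu : alt_bilinear mu) (brho : is_bilinear rho) (lT : linear T).
Let pi := pair_op mu rho.
Let t := single_op T.

Let hpi : bihomog 1 0 pi. Proof. exact: pair_op_bihomog. Qed.
Let ht : bihomog 0 1 t. Proof. exact: single_op_bihomog. Qed.

Lemma pair_single_space : E 0 (pi, t).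
Proof.
split; first by apply/(L'_spaceP charK0).
by apply/(h_spaceP charK0).
Qed.

Definition iter_T : C := br true false (br true false pi t) t.

Lemma iter_T_bihomog : bihomog 1 2 iter_T.
Proof. exact: (bihomog_br _ _ (bihomog_br _ _ hpi ht) ht). Qed.

(** The two copies of [T] can be inserted in either order, hence the factor 2. *)
Lemma iter_T_value u v :
  (iter_T [:: (0, u); (0, v)]).1 =
  (mu (T u) (T v) - T (rho (T u) v - rho (T v) u)) *+ 2.
Proof.
have [[mDl mDr] [m0l m0r] [mNl mNr] _] := bilinear_props amu.1.
have [[rDl rDr] [r0l r0r] [rNl rNr] _] := bilinear_props brho.
have [T0 TD TN TZ] := linear_props lT.
have hN := bihomog_br true false hpi ht.
have N0 ws : size ws != 2 -> br true false pi t ws = 0.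
  by case: hN => _ H _ sz; apply: H; apply/eqP; lia.
have brE (P : C) w1 w2 : br true false P t [:: w1; w2] = circ P t [:: w1;
  w2] - circ t P [:: w1; w2].
  by rewrite /br cochDE cochNE cochZE expr0 scale1r.
have NE w1 w2 : br true false pi t [:: w1; w2] =
    pi [:: t [:: w1]; w2] - pi [:: t [:: w2]; w1] - t [:: pi [:: w1; w2]].
  by rewrite brE !circ_two /= ?oppr0 ?addr0 ?add0r ?subr0.
rewrite /iter_T brE !circ_two.
rewrite (N0 [:: _]) // (N0 [:: _; _; _]) // add0r addr0 !(N0 [:: _]) //.
rewrite !NE /= !(m0l, m0r, r0l, r0r, T0) /= !(subr0, sub0r, addr0, add0r, T0, m0l, m0r,
  r0l, r0r) /=.
rewrite (alt_bilinear_anti (T v) _ amu) !TD TN mulr2n; zmod_cancel.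
Qed.

Lemma natr_scale_eq0 (N : lmodType K) n (w : N) : w *+ n.+1 = 0 -> w = 0.
Proof.
move/eqP; rewrite -scaler_nat scaler_eq0; move/pcharf0P: charK0 => ->.
by move/eqP.
Qed.

(** Having bidegree -1|2, [iter_T] can be nonzero only on two arguments from V, with value in g,
    where [iter_T_value] computes it. *)
Lemma iter_T_eq0 : iter_T = 0 <->
  forall u v, mu (T u) (T v) = T (rho (T u) v - rho (T v) u).
Proof.
split=> [N0 u v | RB].
  by apply/subr0_eq/(@natr_scale_eq0 _ 1); rewrite -iter_T_value N0.
apply: altern_eq0 => [|xs vs]; first exact: bihomog_altern iter_T_bihomog.
have [w1 w2] := bihomog_pure charK0 xs vs iter_T_bihomog.
rewrite [LHS]surjective_pairing; congr pair; last first.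
  by apply/eqP/negP => /negP/eqP/w2[]; lia.
apply/eqP/negP => /negP/eqP w0; have [vs2 xs0] := w1 w0.
case: vs vs2 w0 {w1 w2} => [|u [|v [|? ?]]] // _.
case: xs xs0 => [|? ?] xs0 w0; last by clear w0; move: xs0 => /=; lia.
by apply: w0; have := iter_T_value u v; rewrite RB subrr mul0rn.
Qed.

Lemma br_pair_op_eq0 : br true true pi pi = 0 <-> circ pi pi = 0.
Proof.
rewrite /br expr1 scaleN1r opprK -mulr2n; split=> [/natr_scale_eq0//|->].
by rewrite mul0rn.
Qed.

(** The series stops after arity 3. Arity 2 gives only -[pi, pi], in L'; in arity 3 each of the
    three copies may provide pi, giving 3 [[pi, T], T], in h. The two conditions therefore
    separate. *)
Lemma twist_l_op_pair : twist (@l_op K g V) (pi, t) [::] = 0 <->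
  circ pi pi = 0 /\ iter_T = 0.
Proof.
pose x : X := (0, (pi, t)); have hx : homog x by apply/homog_inP/pair_single_space.
have h0 n : (n != 2)%N -> op_h1 x (nseq n x) = 0.
  move=> n2; apply: (op_h1_eq0 charK0) => //; first by rewrite all_nseq hx orbT.
  by rewrite size_nseq; move=> e; move/eqP: n2; apply; move: e; rewrite /=; lia.
have h2 : op_h1 x [:: x; x] = iter_T.
  by rewrite /op_h1 (proj_h_bihomog charK0 iter_T_bihomog).
have opE n : l_op (nseq n x ++ [::]) = op (nseq n x).
  by rewrite cats0 l_opE // all_nseq hx orbT.
have op1 : op (nseq 1 x) = 0.
  congr pair; rewrite /op_h /= expr0 scale1r addr0; exact: (h0 0%N).
have op2 : op (nseq 2 x) = (- br true true pi pi, 0).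
  congr pair; first by rewrite /= expr1 scaleN1r.
  by rewrite /op_h /= (h0 1%N) // !scaler0 !addr0.
have op3 : op (nseq 3 x) = (0, iter_T *+ 3).
  by congr pair; rewrite /op_h /= h2 !expr0 !scale1r !addr0 !add0r [RHS]mulrS mulr2n addrA.
have lnil := @l_op_nilpotent K charK0 g V.
have Ll := l_op_Linfty_ops charK0 g V.
rewrite (@twistE K _ E (@l_op K g V) 4 lnil _ pair_single_space [::] 4) //; last first.
  by rewrite /degree_norm big_nil.
pose F n : C * C := (n`!%:R : K)^-1 *: op (nseq n x).
rewrite (eq_bigr (fun n : 'I_4 => F n)) => [|n _]; last by rewrite /F -opE.
have sum4 (G : nat -> C * C) : \sum_(n < 4) G n = G 0%N + G 1%N + G 2%N + G 3%N.
  by rewrite !big_ord_recr big_ord0 /= add0r.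
have op0 : op (nseq 0 x) = 0 by [].
rewrite sum4 /F op0 op1 op2 op3 !scaler0 !add0r.
have f0 n : n`!%:R != 0 :> K by move/pcharf0P: charK0 => ->; rewrite -lt0n fact_gt0.
rewrite -br_pair_op_eq0; split=> [H|[-> ->]];
  last by rewrite oppr0 mul0rn -[(0, 0)]/(0 : C * C) !scaler0 addr0.
split.
  have /(congr1 fst) /eqP := H;
    rewrite /= scaler0 addr0 scaler_eq0 invr_eq0 (negPf (f0 _)) /=.
  by rewrite oppr_eq0 => /eqP.
have /(congr1 snd) /eqP := H;
  rewrite /= scaler0 add0r scaler_eq0 invr_eq0 (negPf (f0 _)) /=.
by move/eqP/natr_scale_eq0.
Qed.

Lemma twist_l_op_relative_Rota_Baxter :
  twist (@l_op K g V) (pi, t) [::] = 0 <-> relative_Rota_Baxter mu rho T.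
Proof.
rewrite twist_l_op_pair circ_pair_op_eq0 // iter_T_eq0.
by split=> [[[Lie rep] RB]|[Lie rep _ RB]]; split.
Qed.

End Data.

End RotaBaxter.

Theorem theorem3p15 (K : fieldType) (charK0 : [pchar K] =i pred0)
    (g V : lmodType K) (mu : g -> g -> g) (rho : g -> V -> V) (T : V -> g)
    (hT : relative_Rota_Baxter mu rho T) :
  let pi : cochain g V := lift_mu mu + lift_rho rho in
  let l_twisted := twist (@l_op K g V) (pi, lift_T T) in
  is_Linfty_algebra (@sL'_h K g V) l_twisted /\
  (forall (T' : V -> g) (mu' : g -> g -> g) (rho' : g -> V -> V),
     linear T' -> alt_bilinear mu' -> is_bilinear rho' ->
     (relative_Rota_Baxter (mu + mu') (rho + rho') (T + T') <->
      is_Maurer_Cartan (@sL'_h K g V) l_twisted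
        (lift_mu mu' + lift_rho rho', lift_T T'))).
Proof.
have [[amu _] [brho _] lT _] := hT.
have lnil := @l_op_nilpotent K charK0 g V.
have Ll := l_op_Linfty_ops charK0 g V.
have Ea := pair_single_space charK0 amu brho lT.
have MCa := (twist_l_op_relative_Rota_Baxter charK0 amu brho lT).2 hT.
move=> pi l_twisted; rewrite /l_twisted /pi lift_muE lift_TE; split.
  exact: Linfty_ops_algebra (twist_Linfty_ops charK0 Ll lnil Ea MCa).
move=> T' mu' rho' lT' amu' brho'; rewrite lift_muE lift_TE.
have Eb := pair_single_space charK0 amu' brho' lT'.
rewrite (Maurer_Cartan_twist charK0 Ll lnil Ea Eb MCa).
(* The data enter linearly, so alpha + beta is the element attached to the deformed data. *)
have -> : (pair_op mu rho, single_op T) + (pair_op mu' rho', single_op T') =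
    (pair_op (mu + mu') (rho + rho'), single_op (T + T')) :> cochain g V * cochain g V.
  congr pair; apply/funext => ws; rewrite cochDE.
    case: ws => [|w1 [|w2 [|? ?]]]; rewrite /= ?addr0 //.
    by congr pair; rewrite /= opprD addrACA.
  by case: ws => [|w [|? ?]]; rewrite /= ?addr0 //; congr pair; rewrite /= addr0.
rewrite twist_l_op_relative_Rota_Baxter //.
- exact: alt_bilinear_add.
- exact: is_bilinear_add.
by move=> a x y; rewrite /= !fctE lT lT' scalerDr addrACA.
Qed.
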